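(* Let $g \geq 3$ and let $L \geq 2$ be an integer with $4 \nmid L$. Then $H_1(\mathrm{Sp}_{2g}(\mathbb{Z}/L);\mathfrak{sp}_{2g}(\mathbb{Z}/L)) = 0$.
   Context: Let $\Omega_g = \begin{pmatrix} 0 & I_g \\ -I_g & 0\end{pmatrix}$. For a commutative ring $R$, $\mathrm{Sp}_{2g}(R)$ is the group of $2g\times 2g$ matrices $X$ over $R$ with $X^t\Omega_g X = \Omega_g$, and $\mathfrak{sp}_{2g}(R)$ is the additive group of $2g \times 2g$ matrices $A$ over $R$ with $A^t\Omega_g + \Omega_g A = 0$. $\mathrm{Sp}_{2g}(R)$ acts on $\mathfrak{sp}_{2g}(R)$ by conjugation. $H_1(G;M)$ denotes group homology with coefficients in the $G$-module $M$. *)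

(* Defs.v *)
From HB Require Import structures.
From mathcomp Require Import all_boot all_order all_algebra all_fingroup.

Set Implicit Arguments.
Unset Strict Implicit.
Unset Printing Implicit Defensive.

Import GRing.Theory.
Local Open Scope ring_scope.

Record gmodule (gT : finGroupType) := GModule {
  gmodule_sort :> finZmodType;
  gmod_act : gT -> gmodule_sort -> gmodule_sort;
  gmod_act1 : forall m, gmod_act 1%g m = m;
  gmod_actM : forall x y m, gmod_act (x * y)%g m = gmod_act x (gmod_act y m);
  gmod_actD : forall x m1 m2,
    gmod_act x (m1 + m2) = gmod_act x m1 + gmod_act x m2
}.

Section GroupHomology.

Variables (gT : finGroupType) (M : gmodule gT).

(* The degree n part M (x) Z[G^n] of the (unnormalized, inhomogeneous) bar    *)
(* complex: as G is finite, this is the group of all functions G^n -> M, the  *)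
(* function c standing for \sum_s c(s) (x) [s_0 | ... | s_(n-1)].             *)
Definition chain (n : nat) : Type := {ffun {ffun 'I_n -> gT} -> M}.

HB.instance Definition _ n := GRing.Zmodule.on (chain n).
HB.instance Definition _ n := Finite.on (chain n).
HB.instance Definition _ n := [finGroupMixin of chain n for +%R].

(* The i-th face [s_0 | ... | s_(i-1) * s_i | ... | s_n] of [s_0 | ... | s_n]; *)
(* the first and last faces drop s_0 and s_n respectively.                    *)
Definition bar_face n (i : 'I_n.+2) (s : {ffun 'I_n.+1 -> gT}) :
    {ffun 'I_n -> gT} :=
  [ffun j : 'I_n =>
    let a := s (widen_ord (leqnSn n) j) in
    let b := s (lift ord0 j) in
    if (j.+1 < i)%N then a else if j.+1 == i :> nat then (a * b)%g else b].

(* Dropping s_0 moves it onto the coefficient, through the right action       *)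
(* m . x = x^-1 m attached to the left G-module M.                            *)
Definition bar_coef n (i : 'I_n.+2) (s : {ffun 'I_n.+1 -> gT}) (m : M) : M :=
  if i == ord0 then gmod_act (s ord0)^-1%g m else m.

Definition bar_diff n (c : chain n.+1) : chain n :=
  [ffun t => \sum_(s : {ffun 'I_n.+1 -> gT})
    \sum_(i < n.+2 | bar_face i s == t) bar_coef i s (c s) *~ (-1) ^+ i].

Lemma bar_diffM n :
  {in [set: chain n.+1] &, {morph @bar_diff n : c d / (c * d)%g}}.
Proof.
move=> c d _ _; rewrite -[(c * d)%g]/(c + d).
rewrite -[RHS]/(bar_diff c + bar_diff d); apply/ffunP=> t; rewrite !ffunE.
rewrite -big_split; apply: eq_bigr => s _ /=.
rewrite -big_split; apply: eq_bigr => i _ /=.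
by rewrite -mulrzDl /bar_coef ffunE; case: ifP; rewrite // gmod_actD.
Qed.

Canonical bar_diff_morphism n := Morphism (@bar_diffM n).

Definition cycles n : {group chain n} :=
  match n with 0 => [set: chain 0]%G | m.+1 => ('ker (@bar_diff m))%G end.

Definition boundaries n : {group chain n} :=
  (@bar_diff n @* [set: chain n.+1])%G.

Definition group_homology n : {group coset_of (boundaries n)} :=
  (cycles n / boundaries n)%G.

End GroupHomology.

Section Symplectic.

Variables (R : comNzRingType) (g : nat).
Implicit Types X Y A : 'M[R]_(g + g).

Definition Omega : 'M[R]_(g + g) := block_mx 0 1%:M (- 1%:M) 0.

Definition is_symplectic X := X^T *m Omega *m X == Omega.

Definition is_sp_lie : {pred 'M[R]_(g + g)} :=
  fun A => A^T *m Omega + Omega *m A == 0.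

Record Sp := MkSp { Sp_val :> 'M[R]_(g + g); SpP : is_symplectic Sp_val }.
HB.instance Definition _ := [isSub for Sp_val].
HB.instance Definition _ := [Choice of Sp by <:].

Record sp_lie := MkSpLie {
  sp_lie_val :> 'M[R]_(g + g);
  sp_lieP : sp_lie_val \in is_sp_lie
}.
HB.instance Definition _ := [isSub for sp_lie_val].
HB.instance Definition _ := [Choice of sp_lie by <:].

Lemma is_sp_lie_zmod_closed : zmod_closed is_sp_lie.
Proof.
split=> [|A B]; rewrite !unfold_in.
  by rewrite linear0 mul0mx mulmx0 addr0.
move=> /eqP hA /eqP hB; rewrite linearB /= mulmxBl mulmxBr addrACA -opprD.
by rewrite hA hB subr0.
Qed.

HB.instance Definition _ := GRing.isZmodClosed.Build _ is_sp_lie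
  is_sp_lie_zmod_closed.
HB.instance Definition _ := [SubChoice_isSubZmodule of sp_lie by <:].

Lemma Omega2 : Omega *m Omega = - 1%:M.
Proof.
rewrite /Omega mulmx_block !mul0mx !mulmx0 !mul1mx !mulmx1 !addr0 !add0r.
by rewrite scalar_mx_block opp_block_mx !oppr0.
Qed.

Lemma is_symplectic1 : is_symplectic 1%:M.
Proof. by rewrite /is_symplectic trmx1 mul1mx mulmx1. Qed.

Lemma is_symplecticM X Y :
  is_symplectic X -> is_symplectic Y -> is_symplectic (X *m Y).
Proof.
move=> /eqP hX /eqP hY; rewrite /is_symplectic trmx_mul -!mulmxA.
by rewrite (mulmxA Omega X) (mulmxA X^T) (mulmxA X^T) hX mulmxA hY.
Qed.

Definition Sp_inv_mx X := - (Omega *m X^T *m Omega).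

Lemma Sp_inv_mxl X : is_symplectic X -> Sp_inv_mx X *m X = 1%:M.
Proof.
move=> /eqP hX.
by rewrite /Sp_inv_mx mulNmx -!mulmxA (mulmxA X^T) hX Omega2 opprK.
Qed.

Lemma Sp_inv_mxr X : is_symplectic X -> X *m Sp_inv_mx X = 1%:M.
Proof. by move=> hX; apply: mulmx1C; apply: Sp_inv_mxl. Qed.

Lemma is_symplecticV X : is_symplectic X -> is_symplectic (Sp_inv_mx X).
Proof.
move=> hX; have hr := Sp_inv_mxr hX; rewrite /is_symplectic.
have /eqP {1}<- := hX.
rewrite -!mulmxA hr mulmx1 mulmxA -trmx_mul hr trmx1 mul1mx.
exact: eqxx.
Qed.

Definition Sp_one := MkSp is_symplectic1.
Definition Sp_mul (X Y : Sp) := MkSp (is_symplecticM (SpP X) (SpP Y)).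
Definition Sp_inv (X : Sp) := MkSp (is_symplecticV (SpP X)).

Lemma Sp_mulA : associative Sp_mul.
Proof. by move=> X Y Z; apply: val_inj; rewrite /= mulmxA. Qed.

Lemma Sp_mul1 : left_id Sp_one Sp_mul.
Proof. by move=> X; apply: val_inj; rewrite /= mul1mx. Qed.

Lemma Sp_mulV : left_inverse Sp_one Sp_inv Sp_mul.
Proof. by move=> X; apply: val_inj; rewrite /= Sp_inv_mxl ?SpP. Qed.

Lemma conj_sp_lie (X : Sp) (A : sp_lie) : X *m A *m Sp_inv X \in is_sp_lie.
Proof.
have hX := SpP X; have hr := Sp_inv_mxr hX.
have /eqP hY := is_symplecticV hX; have /eqP hA := sp_lieP A.
rewrite unfold_in /=; set Y := Sp_inv_mx X in hY hr *.
have hXO : X^T *m Omega = Omega *m Y.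
  by move/eqP: hX => {2}<-; rewrite -!mulmxA hr mulmx1.
have hOX : Omega *m X = Y^T *m Omega.
  by rewrite -{1}hY -!mulmxA (Sp_inv_mxl hX) mulmx1.
rewrite !trmx_mul -!mulmxA hXO [Omega *m (X *m _)]mulmxA hOX -!mulmxA.
rewrite -mulmxDr; apply/eqP.
have -> : A^T *m (Omega *m Y) + Omega *m (A *m Y) = 0.
  by rewrite !mulmxA -mulmxDl hA mul0mx.
by rewrite mulmx0.
Qed.

Definition sp_conj (X : Sp) (A : sp_lie) : sp_lie := MkSpLie (conj_sp_lie X A).

End Symplectic.

Section FiniteSymplectic.

Variables (R : finComNzRingType) (g : nat).

HB.instance Definition _ := [Finite of Sp R g by <:].
HB.instance Definition _ :=
  Finite_isGroup.Build (Sp R g) (@Sp_mulA R g) (@Sp_mul1 R g) (@Sp_mulV R g).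
HB.instance Definition _ := [Finite of sp_lie R g by <:].

Lemma sp_conj1 (A : sp_lie R g) : sp_conj 1%g A = A.
Proof.
apply: val_inj => /=.
have -> : Sp_inv_mx (1%:M : 'M[R]_(g + g)) = 1%:M.
  by rewrite -[LHS]mulmx1 Sp_inv_mxl ?is_symplectic1.
by rewrite mul1mx mulmx1.
Qed.

Lemma sp_conjM (X Y : Sp R g) (A : sp_lie R g) :
  sp_conj (X * Y)%g A = sp_conj X (sp_conj Y A).
Proof.
apply: val_inj; rewrite /= -[Sp_inv_mx (X *m Y)]/(val (X * Y)^-1%g).
by rewrite invMg /= !mulmxA.
Qed.

Lemma sp_conjD (X : Sp R g) (A B : sp_lie R g) :
  sp_conj X (A + B) = sp_conj X A + sp_conj X B.
Proof. by apply: val_inj; rewrite /= mulmxDr mulmxDl. Qed.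

Definition sp_module : gmodule (Sp R g) :=
  GModule sp_conj1 sp_conjM sp_conjD.

End FiniteSymplectic.

(* Main.v *)
Require Import Defs.
From mathcomp Require Import all_boot all_order all_algebra all_fingroup.
From mathcomp Require Import all_solvable all_field all_character.
From mathcomp Require Import ring.

(** Write V = (Z/L)^2g with its symplectic form omega, T_v = v v^t Omega
    ([spv v]) and t_v = 1 + T_v, the transvection w |-> w + omega(v, w) v
    ([tv v]).  The T_v span the Lie algebra additively ([sp_lie_span]), so an
    additive function phi : sp_2g -> Z/L is determined by the quadratic form
    v |-> phi(T_v) on V.

    From homology to cocycles.  Characters with values in Z/L separate the
    points of a finite abelian group of exponent dividing L
    ([char_separates]), so it suffices that a character chi of the group of
    1-chains that kills the boundaries also kills the cycles.  Such a chi
    gives c(x)(v) = chi(T_v [x^-1]), a quadratic form in v for every x, with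
    c(xy)(v) = c(x)(yv) + c(y)(v).  When c(x)(v) = F(xv) - F(v) for a form F
    coming from a function phi on sp_2g, chi is phi composed with the
    differential, hence zero on cycles.  What has to be proved is that every
    such cocycle is a coboundary ([cocycle_trivial]).

    The elements x with c(x) = 0 form a subgroup, and Sp_2g(Z/L) is generated
    by the transvections along e_i, f_i and e_i + e_j ([Sp_generation]).  So
    the aim is to subtract coboundaries until c vanishes on these; besides
    generation only relations that hold in the group are used.

    If L = 2m with m odd, then c = mc + (1 - m)c is the sum of a cocycle killed
    by 2 and one killed by m; here the hypothesis that 4 does not divide L
    enters.  In either part the group SL_2 of the i-th hyperbolic plane
    contains an element s_i whose order is invertible on the values of c: a
    rotation with fourth power 1 if the values have odd order, an element of
    order 3 if they are killed by 2.  Averaging makes c vanish on all the s_i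
    ([normalize]).  For x commuting with s_j, the form c(x) is now
    s_j-invariant, which makes the j-th plane orthogonal to the other ones
    ([odd_ortho], [even_ortho]); commutation with transvections in the other
    planes, of which there are at least two, then shows that c(x) lives on
    the i-th plane if x does ([odd_plane], [even_plane]).

    With (x_i, y_i) the coordinates in the i-th plane, comparing c on the
    commuting transvections along e_i and e_i + e_j leaves
    c(t_{e_i}) = b x_i y_i + d y_i^2.  In the odd part b = 2d and this is the
    coboundary of d (x_i^2 + y_i^2).  In the part killed by 2 it is zero,
    because t_v has order dividing 2m with m odd ([even_long_roots]).
    Finally, relations in Sp_4 determine c on t_{e_i + e_j} up to its values
    at f_i and f_j ([pairE]); these vanish in the odd part, and in the part
    killed by 2 they are accounted for by the coboundary of
    sum_k a_k (x_k^2 + x_k y_k + y_k^2).  The coefficients a_k are well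
    defined by a relation in Sp_6 ([even_triple]). *)

Set Implicit Arguments.
Unset Strict Implicit.
Unset Printing Implicit Defensive.

Import GRing.Theory.
Local Open Scope ring_scope.

(** Together with [ring], these two lemmas close a goal that is an integral
    linear consequence of one or two equations. *)
Lemma eq_of_diff (R : comNzRingType) (l r a b : R) : l = r -> a - b = l - r -> a = b.
Proof. by move=> -> /eqP; rewrite subrr subr_eq0 => /eqP. Qed.

Lemma eq_of_diff2 (R : comNzRingType) (l r l' r' a b : R) :
  l = r -> l' = r' -> a - b = (l - r) + (l' - r') -> a = b.
Proof. by move=> -> -> /eqP; rewrite !subrr addr0 subr_eq0 => /eqP. Qed.

(** * Coordinates and transvections *)

Section Transvections.
Variables (R : comNzRingType) (g : nat).
Local Notation V := 'cV[R]_(g + g).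
Local Notation J := (Omega R g).
Implicit Types (u v w : V) (i j k : 'I_g) (a b : R).

Definition xc v i : R := v (lshift g i) 0.
Definition yc v i : R := v (rshift g i) 0.
Definition basis_e i : V := delta_mx (lshift g i) 0.
Definition basis_f i : V := delta_mx (rshift g i) 0.
Local Notation e := basis_e.
Local Notation f := basis_f.
Definition om u v : R := \sum_i (xc u i * yc v i - yc u i * xc v i).

Lemma vecP u v : xc u =1 xc v -> yc u =1 yc v -> u = v.
Proof.
move=> hx hy; apply/matrixP=> p q; rewrite ord1.
by case: (split_ordP p) => i ->; [apply: hx | apply: hy].
Qed.

Lemma xcD u v i : xc (u + v) i = xc u i + xc v i. Proof. by rewrite /xc mxE. Qed.
Lemma ycD u v i : yc (u + v) i = yc u i + yc v i. Proof. by rewrite /yc mxE. Qed.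
Lemma xcN u i : xc (- u) i = - xc u i. Proof. by rewrite /xc mxE. Qed.
Lemma ycN u i : yc (- u) i = - yc u i. Proof. by rewrite /yc mxE. Qed.
Lemma xcZ a u i : xc (a *: u) i = a * xc u i. Proof. by rewrite /xc mxE. Qed.
Lemma ycZ a u i : yc (a *: u) i = a * yc u i. Proof. by rewrite /yc mxE. Qed.
Lemma xc0 i : xc 0 i = 0. Proof. by rewrite /xc mxE. Qed.
Lemma yc0 i : yc 0 i = 0. Proof. by rewrite /yc mxE. Qed.
Lemma xc_e i j : xc (e i) j = (j == i)%:R.
Proof. by rewrite /xc mxE eqxx andbT (inj_eq (@lshift_inj _ _)). Qed.
Lemma yc_f i j : yc (f i) j = (j == i)%:R.
Proof. by rewrite /yc mxE eqxx andbT (inj_eq (@rshift_inj _ _)). Qed.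
Lemma xc_f i j : xc (f i) j = 0.
Proof. by rewrite /xc mxE eq_lrshift. Qed.
Lemma yc_e i j : yc (e i) j = 0.
Proof. by rewrite /yc mxE eq_rlshift. Qed.

Definition coordE := (xcD, ycD, xcN, ycN, xcZ, ycZ, xc0, yc0, xc_e, yc_f, xc_f, yc_e).

Lemma om_mx u v : (u^T *m J *m v) 0 0 = om u v.
Proof.
rewrite -mulmxA mxE big_split_ord /= /om big_split /=; congr (_ + _).
  apply: eq_bigr => i _; rewrite !mxE big_split_ord /= big1 => [|j _]; last first.
    by rewrite /Omega block_mxEul mxE mul0r.
  rewrite (bigD1 i) //= big1 => [|j nji]; rewrite /Omega block_mxEur !mxE.
    by rewrite eqxx mul1r add0r addr0.
  by rewrite eq_sym (negPf nji) mul0r.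
apply: eq_bigr => i _; rewrite !mxE big_split_ord /= [X in _ * (_ + X)]big1 => [|j _]; last first.
  by rewrite /Omega block_mxEdr mxE mul0r.
rewrite (bigD1 i) //= big1 => [|j nji]; rewrite /Omega block_mxEdl !mxE.
  by rewrite eqxx !addr0 mulN1r mulrN.
by rewrite eq_sym (negPf nji) oppr0 mul0r.
Qed.

Lemma omDl u v w : om (u + v) w = om u w + om v w.
Proof. by rewrite /om -big_split /=; apply: eq_bigr => i _; rewrite !coordE; ring. Qed.
Lemma omZl a u v : om (a *: u) v = a * om u v.
Proof. by rewrite /om mulr_sumr; apply: eq_bigr => i _; rewrite !coordE; ring. Qed.
Lemma omC u v : om u v = - om v u.
Proof. by rewrite /om -sumrN; apply: eq_bigr => i _; ring. Qed.
Lemma omNl u v : om (- u) v = - om u v.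
Proof. by rewrite -scaleN1r omZl mulN1r. Qed.
Lemma omDr u v w : om w (u + v) = om w u + om w v.
Proof. by rewrite omC omDl opprD -!omC. Qed.
Lemma omZr a u v : om v (a *: u) = a * om v u.
Proof. by rewrite omC omZl -mulrN -omC. Qed.
Lemma omNr u v : om v (- u) = - om v u.
Proof. by rewrite omC omNl -omC. Qed.
Lemma omvv v : om v v = 0.
Proof. by rewrite /om big1 // => i _; rewrite mulrC subrr. Qed.
Lemma om_e i v : om (e i) v = yc v i.
Proof.
rewrite /om (bigD1 i) //= big1 => [|j nj]; rewrite !coordE ?eqxx ?(negPf nj) /=; ring.
Qed.
Lemma om_f i v : om (f i) v = - xc v i.
Proof.
rewrite /om (bigD1 i) //= big1 => [|j nj]; rewrite !coordE ?eqxx ?(negPf nj) /=; ring.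
Qed.

Definition omE := (omDl, omNl, omZl, om_e, om_f, coordE).

(** The logarithm of the transvection along v, which is 1 + tlog v because tlog v
    has square zero. *)
Definition tlog v : 'M[R]_(g + g) := locked (v *m v^T *m J).

Lemma trJ : J^T = - J.
Proof.
by rewrite /Omega tr_block_mx opp_block_mx !trmx0 linearN /= !trmx1 oppr0 opprK.
Qed.

Lemma tlogE u v : tlog u *m v = om u v *: u.
Proof.
rewrite /tlog -lock -!mulmxA -om_mx -mul_mx_scalar; congr (_ *m _).
by rewrite -mulmxA [LHS]mx11_scalar.
Qed.

Lemma sp_vec (X Y : 'M[R]_(g + g)) : (forall v, X *m v = Y *m v) -> X = Y.
Proof.
move=> h; apply/matrixP=> p q; have := congr1 (fun u : V => u p 0) (h (delta_mx q 0)).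
by rewrite -!colE !mxE.
Qed.

Lemma SpE (X : Sp R g) u v : om (X *m u) (X *m v) = om u v.
Proof.
rewrite -!om_mx trmx_mul.
have -> : u^T *m X^T *m J *m (X *m v) = u^T *m (X^T *m J *m X) *m v by rewrite !mulmxA.
by rewrite (eqP (SpP X)).
Qed.

Lemma is_symplecticP (X : 'M[R]_(g + g)) :
  (forall u v, om (X *m u) (X *m v) = om u v) -> Defs.is_symplectic X.
Proof.
move=> h; apply/eqP/matrixP=> p q.
have := h (delta_mx p 0) (delta_mx q 0).
have E (Y : 'M_(g + g)) : Y p q = ((delta_mx p (0 : 'I_1))^T *m Y *m delta_mx q (0 : 'I_1)) 0 0.
  by rewrite trmx_delta -mulmxA -colE -[delta_mx _ _ *m _]rowE !mxE.
by rewrite -!om_mx !E trmx_mul !mulmxA => ->.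
Qed.

Lemma tv_symplectic v : Defs.is_symplectic (1%:M + tlog v).
Proof.
apply: is_symplecticP => u w; rewrite !mulmxDl !mul1mx !tlogE.
rewrite !omDl !omDr !omZl !omZr omvv (omC u v); ring.
Qed.
Definition tv v : Sp R g := locked (MkSp (tv_symplectic v)).

Lemma tlog_sp v : tlog v \in @is_sp_lie R g.
Proof.
rewrite unfold_in /tlog -lock !trmx_mul trmxK trJ !mulNmx -!mulmxA addNr.
exact: eqxx.
Qed.
Definition spv v : sp_lie R g := MkSpLie (tlog_sp v).

Lemma tvE u v : tv u *m v = v + om u v *: u.
Proof. by rewrite /tv -lock /= mulmxDl mul1mx tlogE. Qed.

End Transvections.

(** * Relations between transvections *)

Section Relations.
Variables (R : finComNzRingType) (g : nat).
Local Notation V := 'cV[R]_(g + g).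
Local Notation G := (Sp R g).
Local Notation e := (basis_e R).
Local Notation f := (basis_f R).
Implicit Types (u v w : V) (i j k : 'I_g) (a b : R) (x y : G).

Lemma SpM x y v : (x * y)%g *m v = x *m (y *m v).
Proof. by rewrite mulmxA. Qed.
Lemma Sp1 v : (1%g : G) *m v = v.
Proof. exact: mul1mx. Qed.
Lemma Sp_ext x y : (forall v, x *m v = y *m v) -> x = y.
Proof. by move=> h; apply: val_inj; apply: sp_vec. Qed.
Lemma SpK x v : x^-1%g *m (x *m v) = v.
Proof. by rewrite -SpM mulVg Sp1. Qed.

(** Transvections are permuted by conjugation like their axes; every relation
    below that involves a commutation or a change of axis is an instance. *)
Lemma tv_conj x v : (x * tv v = tv (x *m v) * x)%g.
Proof. by apply: Sp_ext => u; rewrite !SpM !tvE mulmxDr -scalemxAr SpE. Qed.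

Lemma tv_comm u v : om u v = 0 -> (tv u * tv v = tv v * tv u)%g.
Proof. by move=> h; rewrite tv_conj tvE h scale0r addr0. Qed.

Lemma tvN v : tv (- v) = tv v.
Proof. by apply: Sp_ext => u; rewrite !tvE omNl scalerN scaleNr opprK. Qed.

Lemma tvX u n w : (tv u ^+ n)%g *m w = w + (n%:R * om u w) *: u.
Proof.
elim: n => [|n IH]; first by rewrite Sp1 mul0r scale0r addr0.
rewrite expgS SpM IH tvE omDr omZr omvv mulr0 addr0 -addrA -scalerDl; congr (_ + _ *: _).
by rewrite -natr1; ring.
Qed.

Lemma tvV u w : (tv u)^-1%g *m w = w - om u w *: u.
Proof.
rewrite -[X in _ = X](SpK (tv u)); congr (_ *m _).
by rewrite tvE omDr omNr omZr omvv mulr0 subr0 subrK.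
Qed.

(** The rotation e i |-> - f i, f i |-> e i of the i-th plane; its square is - 1 on
    that plane. *)
Definition rot i : G := locked (tv (e i) * tv (f i) * tv (e i))%g.

Lemma rot_def i : rot i = (tv (e i) * tv (f i) * tv (e i))%g.
Proof. by rewrite /rot -lock. Qed.

Lemma rotE i v :
  rot i *m v = v + ((yc v i - xc v i) *: e i - (xc v i + yc v i) *: f i).
Proof.
rewrite rot_def !SpM !tvE !omE ?eqxx /=; apply: vecP => k; rewrite !coordE ?eqxx /=; ring.
Qed.
Lemma rot2E i v : (rot i ^+ 2)%g *m v = v - 2%:R *: (xc v i *: e i + yc v i *: f i).
Proof.
rewrite expgS expg1 SpM rotE [rot i *m v]rotE !coordE ?eqxx /=.
by apply: vecP => k; rewrite !coordE; ring.
Qed.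

Lemma rot4 i : (rot i ^+ 4 = 1)%g.
Proof.
apply: Sp_ext => v; rewrite (expgM _ 2 2) expgS expg1 SpM rot2E rot2E Sp1 !coordE ?eqxx /=.
by apply: vecP => k; rewrite !coordE; ring.
Qed.

(** The element e i |-> - e i - f i, f i |-> e i of order 3.  The
    product of the two transvections has its cube equal to - 1 on the plane,
    whence the square. *)
Definition ord3 i : G := locked ((tv (e i) * tv (f i)) ^+ 2)%g.
Lemma ord3_def i : ord3 i = ((tv (e i) * tv (f i)) ^+ 2)%g.
Proof. by rewrite /ord3 -lock. Qed.

Lemma ord3E i v : ord3 i *m v =
  v + ((yc v i - 2%:R * xc v i) *: e i - (xc v i + yc v i) *: f i).
Proof.
rewrite ord3_def expgS expg1 !SpM !tvE !omE ?eqxx /=; apply: vecP => k; rewrite !coordE ?eqxx /=; ring.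
Qed.
Lemma ord3X i : (ord3 i ^+ 3 = 1)%g.
Proof.
have E v : (ord3 i ^+ 2)%g *m v =
    v + (- (xc v i + yc v i) *: e i + (xc v i - 2%:R * yc v i) *: f i).
  rewrite expgS expg1 SpM ord3E [ord3 i *m v]ord3E !coordE ?eqxx /=.
  by apply: vecP => k; rewrite !coordE; ring.
apply: Sp_ext => v; rewrite expgS SpM ord3E E Sp1 !coordE ?eqxx /=.
by apply: vecP => k; rewrite !coordE; ring.
Qed.

(** The linear map that adds the i-th e-coordinate to the j-th one, and is
    corrected in the f-coordinates so as to be symplectic. *)
Definition shear i j : G := locked (tv (e j - f i) * (tv (e j))^-1 * (tv (f i))^-1)%g.
Lemma shear_def i j : shear i j = (tv (e j - f i) * (tv (e j))^-1 * (tv (f i))^-1)%g.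
Proof. by rewrite /shear -lock. Qed.

Lemma shearE i j v : i != j ->
  shear i j *m v = v + (xc v i *: e j - yc v j *: f i).
Proof.
move=> nij; rewrite shear_def !SpM !tvE !tvV !omE (negPf nij) eq_sym (negPf nij) ?eqxx /=.
by apply: vecP => k; rewrite !coordE ?eqxx /=; ring.
Qed.
Lemma shearX i j n v : i != j ->
  (shear i j ^+ n)%g *m v = v + n%:R *: (xc v i *: e j - yc v j *: f i).
Proof.
move=> nij; have nji : (j == i) = false by rewrite eq_sym (negPf nij).
elim: n => [|n IH]; first by rewrite Sp1 scale0r addr0.
rewrite expgS SpM IH shearE // -natr1; apply: vecP => k.
  by rewrite !coordE ?eqxx ?nji ?(negPf nij) /=; ring.
by rewrite !coordE ?eqxx ?nji ?(negPf nij) /=; ring.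
Qed.

Lemma rot_ee i j : i != j -> rot i *m (e j + e i) = e j - f i.
Proof.
move=> nij; have nji : (j == i) = false by rewrite eq_sym (negPf nij).
by rewrite rotE; apply: vecP => k; rewrite !coordE ?eqxx ?nji ?(negPf nij) /=; ring.
Qed.

End Relations.

(** * Generation of the symplectic group over Z/L *)

Section Generation.
Variables (L g : nat) (hL : (1 < L)%N).
Local Notation R := 'Z_L.
Local Notation V := 'cV[R]_(g + g).
Local Notation G := (Sp R g).
Local Notation e := (basis_e R).
Local Notation f := (basis_f R).
Implicit Types (u v w : V) (i j k : 'I_g) (a b : R) (x y : G).

Variable K : {group G}.
Hypothesis Ke : forall i, tv (e i) \in K.
Hypothesis Kf : forall i, tv (f i) \in K.
Hypothesis Kee : forall i j, i != j -> tv (e i + e j) \in K.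

Lemma K_rot i : rot R i \in K.
Proof. by rewrite rot_def !groupM. Qed.

Lemma K_conj x v : x \in K -> tv v \in K -> tv (x *m v) \in K.
Proof.
move=> xK vK; have -> : (tv (x *m v) = x * tv v * x^-1)%g by rewrite tv_conj mulgK.
by rewrite !groupM ?groupV.
Qed.

Lemma K_shear i j : i != j -> shear R i j \in K.
Proof.
move=> nij; rewrite shear_def !groupM ?groupV // -rot_ee //; apply: K_conj; first exact: K_rot.
by apply: Kee; rewrite eq_sym.
Qed.

Variable S : {set 'I_g}.

(** The induction that proves generation fixes one hyperbolic plane after the
    other; the elements of K that do not disturb the planes in S are the ones
    allowed at the next step. *)
Definition Kfix_set := [set x in K | [forall j in S, (x *m e j == e j) && (x *m f j == f j)]].

Lemma Kfix_group_set : group_set Kfix_set.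
Proof.
apply/group_setP; split=> [|x y].
  by rewrite inE group1; apply/forall_inP=> j _; rewrite !Sp1 !eqxx.
rewrite !inE => /andP[xK /forall_inP hx] /andP[yK /forall_inP hy].
rewrite groupM //; apply/forall_inP=> j jS; rewrite !SpM.
case/andP: (hy j jS) => /eqP -> /eqP ->; exact: hx.
Qed.
Definition Kfix := Group Kfix_group_set.

Lemma KfixP x : reflect
  (x \in K /\ forall j, j \in S -> x *m e j = e j /\ x *m f j = f j) (x \in Kfix).
Proof.
rewrite inE; apply: (iffP andP) => -[xK h]; split=> //.
  by move=> j jS; case/andP: (forall_inP h j jS) => /eqP-> /eqP->.
by apply/forall_inP=> j jS; case: (h j jS) => -> ->; rewrite !eqxx.
Qed.

Lemma Kfix_coord x v j : x \in Kfix -> j \in S ->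
  xc (x *m v) j = xc v j /\ yc (x *m v) j = yc v j.
Proof.
move=> /KfixP[_ h] jS; case: (h j jS) => h1 h2; split.
  by apply: oppr_inj; rewrite -!om_f -{1}h2 SpE.
by rewrite -!om_e -{1}h1 SpE.
Qed.

Lemma Kfix_tv v : tv v \in K ->
  (forall j, j \in S -> xc v j = 0 /\ yc v j = 0) -> tv v \in Kfix.
Proof.
move=> vK hv; apply/KfixP; split=> // j jS; case: (hv j jS) => h1 h2.
by rewrite !tvE !(omC v) om_e om_f h1 h2 !oppr0 !scale0r !addr0.
Qed.

Lemma Kfix_e i : i \notin S -> tv (e i) \in Kfix.
Proof.
move=> iS; apply: Kfix_tv => // j jS; rewrite !coordE; split=> //.
by case: eqP => // E; rewrite -E jS in iS.
Qed.
Lemma Kfix_f i : i \notin S -> tv (f i) \in Kfix.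
Proof.
move=> iS; apply: Kfix_tv => // j jS; rewrite !coordE; split=> //.
by case: eqP => // E; rewrite -E jS in iS.
Qed.
Lemma Kfix_rot i : i \notin S -> rot R i \in Kfix.
Proof.
move=> iS; rewrite rot_def; exact: groupM (groupM (Kfix_e iS) (Kfix_f iS)) (Kfix_e iS).
Qed.
Lemma Kfix_shear i j : i != j -> i \notin S -> j \notin S -> shear R i j \in Kfix.
Proof.
move=> nij iS jS; apply/KfixP; split; first exact: K_shear.
move=> k kS; rewrite !shearE // !coordE.
have -> : (i == k) = false by apply: contraNF iS => /eqP->.
have -> : (j == k) = false by apply: contraNF jS => /eqP->.
by rewrite !scale0r !subr0 !addr0.
Qed.

Lemma Zp_divide (a c : R) : (0 < (c : nat))%N ->
   exists q r : nat, [/\ a = q%:R * c + r%:R & ((r%:R : R) < c)%N].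
Proof.
move=> cp; exists (a %/ c)%N, (a %% c)%N; split.
  by rewrite -[c in _ * c]natr_Zp -natrM -natrD -divn_eq natr_Zp.
have h := ltn_pmod a cp; rewrite (@leq_ltn_trans (a %% c)%N) //.
by rewrite val_Zp_nat // leq_mod.
Qed.

(** Euclid's algorithm on the orbit of a unimodular vector: u0 is chosen in its
    orbit so that its j0-th e-coordinate c has the least nonzero representative
    that occurs as an e-coordinate anywhere in the orbit. *)
Section Orbit.
Variables (u0 : V) (j0 : 'I_g).
Hypothesis j0S : j0 \notin S.
Local Notation c := (xc u0 j0).
Hypothesis u0S : forall j, j \in S -> xc u0 j = 0 /\ yc u0 j = 0.
Hypothesis min0 : forall x j, x \in Kfix -> j \notin S ->
  (nat_of_ord (xc (x *m u0) j) < c)%N -> xc (x *m u0) j = 0.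
Hypothesis c0 : c != 0.

(** Subtracting a multiple of c from another coordinate leaves a remainder less
    than c, which is zero by minimality. *)
Lemma orbit_dvd_x x j : x \in Kfix -> j \notin S -> j != j0 -> xc (x *m u0) j0 = c ->
  exists d, xc (x *m u0) j = c * d.
Proof.
move=> xK jS nj hx; have cp : (0 < (c : nat))%N by rewrite lt0n; apply: contraNneq c0 => h; apply/eqP/val_inj.
have [q [r [E rc]]] := Zp_divide (xc (x *m u0) j) cp; exists q%:R; rewrite E.
have nj' : j0 != j by rewrite eq_sym.
pose m : R := - q%:R.
have Ez : xc ((shear R j0 j ^+ (nat_of_ord m) * x)%g *m u0) j = r%:R.
  by rewrite SpM shearX // !coordE eqxx natr_Zp hx E /m /=; ring.
have := min0 (groupM (groupX m (Kfix_shear nj' j0S jS)) xK) jS.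
by rewrite Ez => -> //; rewrite addr0 mulrC.
Qed.

(** The f-coordinates become e-coordinates after a rotation, so c divides all
    coordinates of u0, and therefore om u0 v = 1. *)
Lemma orbit_unit v : om u0 v = 1 -> exists d, c * d = 1.
Proof.
move=> h1.
have dvd_x j : exists d, xc u0 j = c * d.
  case: (boolP (j \in S)) => [/u0S[-> _]|jS]; first by exists 0; rewrite mulr0.
  case: (eqVneq j j0) => [->|nj]; first by exists 1; rewrite mulr1.
  by have := @orbit_dvd_x 1%g j; rewrite Sp1; apply.
have dvd_y j : exists d, yc u0 j = c * d.
  case: (boolP (j \in S)) => [/u0S[_ ->]|jS]; first by exists 0; rewrite mulr0.
  have E w : xc (rot R j *m w) j = yc w j by rewrite rotE !coordE eqxx /=; ring.
  case: (eqVneq j j0) => [->|nj].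
    have cp : (0 < (c : nat))%N by rewrite lt0n; apply: contraNneq c0 => h; apply/eqP/val_inj.
    have [q [r [Ey rc]]] := Zp_divide (yc u0 j0) cp; exists q%:R; rewrite Ey.
    have Ez : xc ((rot R j0 * tv (f j0) ^+ q)%g *m u0) j0 = r%:R.
      by rewrite SpM rotE tvX !omE eqxx Ey /=; ring.
    have := min0 (groupM (Kfix_rot j0S) (groupX q (Kfix_f j0S))) j0S.
    by rewrite Ez => -> //; rewrite addr0 mulrC.
  rewrite -E; apply: orbit_dvd_x => //; first exact: Kfix_rot.
  by rewrite rotE !coordE eq_sym (negPf nj) /=; ring.
have [d hd] : exists d, om u0 v = c * d.
  rewrite /om; elim/big_ind: _ => [|x y [d1 ->] [d2 ->]|i _].
  - by exists 0; rewrite mulr0.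
  - by exists (d1 + d2); rewrite mulrDr.
  have [[d1 ->] [d2 ->]] := (dvd_x i, dvd_y i).
  by exists (d1 * yc v i - d2 * xc v i); ring.
by exists d; rewrite -hd.
Qed.

End Orbit.

(** Once some coordinate is a unit, any other coordinate can be turned into 1 by
    adding a multiple of it. *)
Lemma orbit_one u v i : i \notin S -> (forall j, j \in S -> xc u j = 0 /\ yc u j = 0) ->
  om u v = 1 -> exists2 x, x \in Kfix & xc (x *m u) i = 1.
Proof.
move=> iS uS h1.
pose P n := [exists x in Kfix, exists j, [&& j \notin S, xc (x *m u) j != 0 & nat_of_ord (xc (x *m u) j) == n]].
have exP : exists n, P n.
  have [j hj] : exists j, (xc u j != 0) || (yc u j != 0).
    apply/existsP; apply: contra_eqT h1; rewrite negb_exists => /forallP h.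
    rewrite /om big1 ?(eq_sym 0) ?oner_neq0 // => j _.
    by have := h j; rewrite negb_or !negbK => /andP[/eqP-> /eqP->]; rewrite !mul0r subrr.
  have jS : j \notin S by apply/negP => /uS[E1 E2]; rewrite E1 E2 eqxx in hj.
  case/orP: hj => hj.
    exists (nat_of_ord (xc u j)); apply/exists_inP; exists 1%g; first exact: group1.
    by apply/existsP; exists j; rewrite Sp1 jS hj eqxx.
  exists (nat_of_ord (yc u j)); apply/exists_inP; exists (rot R j); first exact: Kfix_rot.
  apply/existsP; exists j.
  have -> : xc (rot R j *m u) j = yc u j by rewrite rotE !coordE eqxx /=; ring.
  by rewrite jS hj eqxx.
case: (ex_minnP exP) => n /exists_inP[x0 x0K /existsP[j0 /and3P[j0S nz /eqP En]]] nmin.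
set u0 := x0 *m u in nz En.
have u0S j : j \in S -> xc u0 j = 0 /\ yc u0 j = 0.
  by move=> jS; rewrite /u0; have [-> ->] := Kfix_coord u x0K jS; apply: uS.
have min0 x j : x \in Kfix -> j \notin S ->
  (nat_of_ord (xc (x *m u0) j) < nat_of_ord (xc u0 j0))%N -> xc (x *m u0) j = 0.
  move=> xK jS lt; apply/eqP; apply: contraLR lt => h; rewrite -leqNgt En; apply: nmin.
  apply/exists_inP; exists (x * x0)%g; first exact: groupM; apply/existsP; exists j.
  by rewrite SpM jS h eqxx.
have om1 : om u0 (x0 *m v) = 1 by rewrite SpE.
have [d hd] := orbit_unit j0S u0S min0 nz om1.
suff [x xK hx] : exists2 x, x \in Kfix & xc (x *m u0) i = 1.
  by exists (x * x0)%g; [exact: groupM|rewrite SpM].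
case: (eqVneq j0 i) => [E|nj].
  (* The unit is already in place i: make the f-coordinate 1 first, then use it
     to correct the e-coordinate. *)
  rewrite E in hd; set c := xc u0 i in hd.
  pose a : R := d * (yc u0 i - 1); pose b : R := 1 - c.
  exists (tv (e i) ^+ (nat_of_ord b) * tv (f i) ^+ (nat_of_ord a))%g.
    exact: groupM (groupX _ (Kfix_e iS)) (groupX _ (Kfix_f iS)).
  rewrite SpM !tvX !omE !natr_Zp eqxx /= -/c.
  have -> : yc u0 i + a * - c * 1%:R = 1.
    have -> : yc u0 i + a * - c * 1%:R = yc u0 i - (c * d) * (yc u0 i - 1) by rewrite /a; ring.
    by rewrite hd; ring.
  by rewrite /b; ring.
pose a : R := d * (1 - xc u0 i).
exists (shear R j0 i ^+ (nat_of_ord a))%g; first exact: groupX (Kfix_shear nj j0S iS).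
rewrite shearX // !coordE eqxx natr_Zp /=.
have -> : xc u0 i + a * (xc u0 j0 * 1%:R - yc u0 i * 0) =
  xc u0 i + (xc u0 j0 * d) * (1 - xc u0 i) by rewrite /a; ring.
by rewrite hd; ring.
Qed.

(** With a coordinate equal to 1 the other planes are cleared one at a time: a
    shear kills the e-coordinate, a rotation exchanges the two coordinates,
    and a second shear kills the other one.  All of this only affects the i-th
    f-coordinate, which is cleared last by a power of tv (f i). *)
Lemma orbit_e u v i : i \notin S -> (forall j, j \in S -> xc u j = 0 /\ yc u j = 0) ->
  om u v = 1 -> exists2 x, x \in Kfix & x *m u = e i.
Proof.
move=> iS uS h1; have [x0 x0K hx0] := orbit_one iS uS h1.
pose u0 := x0 *m u.
have u0S j : j \in S -> xc u0 j = 0 /\ yc u0 j = 0.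
  by move=> jS; rewrite /u0; have [-> ->] := Kfix_coord u x0K jS; apply: uS.
have H (s : seq 'I_g) : exists x, [/\ x \in Kfix, xc (x *m u0) i = 1 &
    forall j, j \in s -> j != i -> xc (x *m u0) j = 0 /\ yc (x *m u0) j = 0].
  elim: s => [|j s [x [xK hx hs]]]; first by exists 1%g; rewrite Sp1; split=> //; exact: group1.
  case: (eqVneq j i) => [->|nj].
    exists x; split=> // k; rewrite inE => /orP[/eqP->|]; first by rewrite eqxx.
    exact: hs.
  case: (boolP (j \in S)) => jS.
    exists x; split=> // k; rewrite inE => /orP[/eqP->|] nk; last exact: hs.
    by have [-> ->] := Kfix_coord u0 xK jS; apply: u0S.
  have nij : i != j by rewrite eq_sym.
  have kill w : xc w i = 1 -> exists x, [/\ x \in Kfix, xc (x *m w) j = 0,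
      forall k, k != j -> xc (x *m w) k = xc w k
      & forall k, k != i -> yc (x *m w) k = yc w k].
    move=> hw; exists (shear R i j ^+ (nat_of_ord (- xc w j)))%g.
    split; first exact: groupX (Kfix_shear nij iS jS).
    - by rewrite shearX // !coordE natr_Zp hw eqxx /=; ring.
    - by move=> k nk; rewrite shearX // !coordE (negPf nk) /=; ring.
    - by move=> k nk; rewrite shearX // !coordE (negPf nk) /=; ring.
  have [x1 [x1K xj1 xk1 yk1]] := kill _ hx.
  set w := x1 *m (x *m u0) in xj1 xk1 yk1.
  have rx k : xc (rot R j *m w) k = if k == j then yc w j else xc w k.
    by rewrite rotE !coordE; case: eqP => [->|_] /=; ring.
  have ry k : yc (rot R j *m w) k = if k == j then 0 else yc w k.
    by rewrite rotE !coordE; case: eqP => [->|_] /=; rewrite ?xj1; ring.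
  have [|x2 [x2K xj2 xk2 yk2]] := kill (rot R j *m w).
    by rewrite rx (negPf nij) (xk1 _ nij).
  exists (x2 * (rot R j * (x1 * x)))%g; rewrite !SpM -/w; split.
  - exact: groupM x2K (groupM (Kfix_rot jS) (groupM x1K xK)).
  - by rewrite (xk2 _ nij) rx (negPf nij) (xk1 _ nij).
  move=> k; rewrite inE => ks nk; rewrite (yk2 _ nk) ry.
  case: (eqVneq k j) ks => [->|nkj] /= ks; first by rewrite xj2.
  by rewrite (xk2 _ nkj) rx (negPf nkj) (xk1 _ nkj) (yk1 _ nk); apply: hs.
have [x [xK hx hs]] := H (enum 'I_g).
exists (tv (f i) ^+ (nat_of_ord (yc (x *m u0) i)) * x * x0)%g.
  exact: groupM (groupM (groupX _ (Kfix_f iS)) xK) x0K.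
rewrite !SpM -/u0 tvX !omE natr_Zp hx; apply: vecP => j; rewrite !coordE.
  case: (eqVneq j i) => [->|nj] /=; first by rewrite hx; ring.
  by have [-> _] := hs j (mem_enum _ j) nj; ring.
case: (eqVneq j i) => [->|nj] /=; first by ring.
by have [_ ->] := hs j (mem_enum _ j) nj; ring.
Qed.

End Generation.

Section PlaneByPlane.
Variables (L g : nat) (hL : (1 < L)%N).
Local Notation R := 'Z_L.
Local Notation V := 'cV[R]_(g + g).
Local Notation G := (Sp R g).
Local Notation e := (basis_e R).
Local Notation f := (basis_f R).
Implicit Types (u v w : V) (i j k : 'I_g) (a b : R) (x y : G).

Variable K : {group G}.
Hypothesis Ke : forall i, tv (e i) \in K.
Hypothesis Kf : forall i, tv (f i) \in K.
Hypothesis Kee : forall i j, i != j -> tv (e i + e j) \in K.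

(** First e i is brought back by transitivity.  The image u of f i then satisfies
    om (e i) u = 1, and a power of tv (e i) changes its i-th e-coordinate at
    will.  If that coordinate is - 1, then om (f i - u) u = 1, so the
    transvection along f i - u maps u to f i; it fixes e i, and it lies in K
    because its axis is unimodular, hence in the orbit of e i. *)
Lemma fix_plane (S : {set 'I_g}) x i :
  (forall j, j \in S -> x *m e j = e j /\ x *m f j = f j) ->
  exists2 y, y \in K &
    forall j, j \in i |: S -> (y * x)%g *m e j = e j /\ (y * x)%g *m f j = f j.
Proof.
move=> xS; case: (boolP (i \in S)) => iS.
  exists 1%g => // j; rewrite mul1g => /setU1P[->|]; first exact: xS.
  exact: xS.
have coordS v (y : G) : (forall j, j \in S -> y *m e j = e j /\ y *m f j = f j) ->
  (forall j, j \in S -> xc v j = 0 /\ yc v j = 0) ->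
  forall j, j \in S -> xc (y *m v) j = 0 /\ yc (y *m v) j = 0.
  move=> yS vS j jS; case: (yS j jS) => h1 h2; case: (vS j jS) => v1 v2; split.
    by rewrite -v1; apply: oppr_inj; rewrite -!om_f -{1}h2 SpE.
  by rewrite -v2 -!om_e -{1}h1 SpE.
have eS j : j \in S -> xc (e i) j = 0 /\ yc (e i) j = 0.
  by move=> jS; rewrite !coordE; case: eqP => // E; rewrite -E jS in iS.
have fS j : j \in S -> xc (f i) j = 0 /\ yc (f i) j = 0.
  by move=> jS; rewrite !coordE; case: eqP => // E; rewrite -E jS in iS.
have om1 : om (e i) (f i) = 1 by rewrite om_e coordE eqxx.
have [y yK hy] : exists2 y, y \in Kfix K S & y *m (x *m e i) = e i.
  apply: (orbit_e hL Ke Kf Kee (v := x *m f i) iS); last by rewrite SpE.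
  exact: coordS xS eS.
have yS j : j \in S -> (y * x)%g *m e j = e j /\ (y * x)%g *m f j = f j.
  move=> jS; rewrite !SpM; case: (xS j jS) => -> ->.
  by case/KfixP: yK => _; apply.
pose u := (y * x)%g *m f i.
have uS := coordS _ _ yS fS; rewrite -/u in uS.
have yu : yc u i = 1 by rewrite -om_e -{1}hy -SpM SpE.
(* The power of tv (e i) that makes the i-th e-coordinate of u equal to - 1. *)
pose m : R := - 1 - xc u i.
pose z := (tv (e i) ^+ (nat_of_ord m))%g.
have zu : z *m u = u + m *: e i by rewrite tvX natr_Zp om_e yu mulr1.
have zK : z \in Kfix K S by rewrite groupX ?Kfix_e.
pose b := f i - z *m u.
have bS j : j \in S -> xc b j = 0 /\ yc b j = 0.
  move=> jS; rewrite /b zu !coordE; have [-> ->] := uS j jS.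
  by case: eqP => [E|_]; [rewrite -E jS in iS | split=> /=; ring].
have [t tK ht] : exists2 t, t \in Kfix K S & t *m b = e i.
  apply: (orbit_e hL Ke Kf Kee (v := f i) iS bS).
  by rewrite omC om_f /b zu !coordE eqxx /m /=; ring.
have bK : tv b \in Kfix K S.
  have -> : b = (t^-1)%g *m e i by rewrite -ht SpK.
  have -> : (tv ((t^-1)%g *m e i) = t^-1 * tv (e i) * t)%g.
    by rewrite tv_conj -mulgA mulVg mulg1.
  by rewrite !groupM ?groupV ?Kfix_e.
have qK : (tv b * z * y)%g \in Kfix K S by rewrite !groupM.
exists (tv b * z * y)%g; first by case/KfixP: qK.
have ze : z *m e i = e i by rewrite tvX omvv mulr0 scale0r addr0.
move=> j /setU1P[->|jS].
  have -> : (tv b * z * y * x = tv b * (z * (y * x)))%g by rewrite !mulgA.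
  rewrite !(SpM (tv b)) !(SpM z) -/u; split.
    rewrite SpM hy ze tvE omC om_e /b zu !coordE eqxx yu /=.
    by rewrite (_ : - _ = 0) ?scale0r ?addr0 //; ring.
  rewrite tvE {1}/b (_ : om _ _ = 1); first by rewrite scale1r addrC subrK.
  by rewrite omDl omNl omvv om_f zu !coordE eqxx /m /=; ring.
rewrite !(SpM (tv b * z * y)%g); case: (xS j jS) => -> ->.
by case/KfixP: qK => _; apply.
Qed.

Lemma Sp_generation : K = [set: G] :> {set G}.
Proof.
apply/eqP; rewrite eqEsubset subsetT; apply/subsetP=> x _.
have H (s : seq 'I_g) : exists2 y, y \in K &
    forall j, j \in [set k in s] -> (y * x)%g *m e j = e j /\ (y * x)%g *m f j = f j.
  elim: s => [|i s [y yK ys]]; first by exists 1%g => // j; rewrite inE.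
  have [z zK zs] := fix_plane i ys; exists (z * y)%g; first exact: groupM.
  by move=> j js; rewrite -mulgA; apply: zs; move: js; rewrite !inE.
have [y yK ys] := H (enum 'I_g).
suff E : (y * x = 1)%g by rewrite -(groupMl x yK) E group1.
have {}ys j : (y * x)%g *m e j = e j /\ (y * x)%g *m f j = f j.
  by apply: ys; rewrite inE mem_enum.
apply: Sp_ext => v; rewrite Sp1; apply: vecP => j; case: (ys j) => h1 h2.
  by apply: oppr_inj; rewrite -!om_f -{1}h2 SpE.
by rewrite -!om_e -{1}h1 SpE.
Qed.

End PlaneByPlane.

(** * Quadratic forms and functionals on the Lie algebra *)

Section Quadratic.
Variables (R : comNzRingType) (g : nat).
Local Notation V := 'cV[R]_(g + g).
Local Notation e := (basis_e R).
Local Notation f := (basis_f R).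
Implicit Types (u v w : V) (i j k : 'I_g) (a b : R) (q : V -> R).

Definition polar q u v := q (u + v) - q u - q v.

Record quadr q : Prop := Quadr {
  qZ : forall a u, q (a *: u) = a ^+ 2 * q u;
  qBD : forall u v w, polar q (u + v) w = polar q u w + polar q v w;
  qBZ : forall a u v, polar q (a *: u) v = a * polar q u v }.

Lemma polarC q u v : polar q u v = polar q v u.
Proof. by rewrite /polar [u + v]addrC; ring. Qed.

Lemma qD q u v : q (u + v) = q u + q v + polar q u v.
Proof. by rewrite /polar; ring. Qed.

Variable q : V -> R.
Hypothesis hq : quadr q.

Lemma q0 : q 0 = 0.
Proof. by rewrite -(scale0r 0) (qZ hq); ring. Qed.
Lemma qN u : q (- u) = q u.
Proof. by rewrite -scaleN1r (qZ hq); ring. Qed.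
Lemma qBN u v : polar q (- u) v = - polar q u v.
Proof. by rewrite -scaleN1r (qBZ hq); ring. Qed.
Lemma qBDr u v w : polar q w (u + v) = polar q w u + polar q w v.
Proof. by rewrite polarC (qBD hq) !(polarC _ w). Qed.
Lemma qBZr a u v : polar q v (a *: u) = a * polar q v u.
Proof. by rewrite polarC (qBZ hq) !(polarC _ v). Qed.
Lemma qBNr u v : polar q v (- u) = - polar q v u.
Proof. by rewrite polarC qBN polarC. Qed.
Lemma qBvv u : polar q u u = 2%:R * q u.
Proof. by rewrite /polar -mulr2n -scaler_nat (qZ hq); ring. Qed.

Definition rad u := forall v, q (u + v) = q v.

Lemma radP u : q u = 0 -> (forall v, polar q u v = 0) -> rad u.
Proof. by move=> h1 h2 v; rewrite qD h1 h2 add0r addr0. Qed.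
Lemma rad_q u : rad u -> q u = 0.
Proof. by move=> h; rewrite -[u]addr0 h q0. Qed.
Lemma rad_polar u v : rad u -> polar q u v = 0.
Proof. by move=> h; rewrite /polar h (rad_q h); ring. Qed.
Lemma radZ a u : rad u -> rad (a *: u).
Proof.
move=> h; apply: radP; first by rewrite (qZ hq) (rad_q h) mulr0.
by move=> v; rewrite (qBZ hq) rad_polar // mulr0.
Qed.
Lemma radD u v : rad u -> rad v -> rad (u + v).
Proof. by move=> h1 h2 w; rewrite -addrA h1 h2. Qed.
Lemma radN u : rad u -> rad (- u).
Proof. by rewrite -scaleN1r; apply: radZ. Qed.

Definition plane_part i v : V := xc v i *: e i + yc v i *: f i.

Lemma vec_sum v : v = \sum_i plane_part i v.
Proof.
have xs i (F : 'I_g -> V) : xc (\sum_j F j) i = \sum_j xc (F j) i by rewrite /xc summxE.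
have ys i (F : 'I_g -> V) : yc (\sum_j F j) i = \sum_j yc (F j) i by rewrite /yc summxE.
apply: vecP => i; rewrite ?xs ?ys (bigD1 i) //= big1 => [|j nj]; rewrite /plane_part !coordE ?eqxx /=.
- by ring.
- by rewrite eq_sym (negPf nj) /=; ring.
- by ring.
by rewrite eq_sym (negPf nj) /=; ring.
Qed.

Lemma rad_plane i :
  (forall v, xc v i = 0 -> yc v i = 0 -> polar q (e i) v = 0 /\ polar q (f i) v = 0) ->
  q (e i) = 0 -> q (f i) = 0 -> polar q (e i) (f i) = 0 -> rad (e i) /\ rad (f i).
Proof.
move=> ho he hf hef.
have E v : v = (v - plane_part i v) + (xc v i *: e i + yc v i *: f i) by rewrite subrK.
have XY v : xc (v - plane_part i v) i = 0 /\ yc (v - plane_part i v) i = 0.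
  by rewrite /plane_part !coordE eqxx /=; split; ring.
split; apply: radP => // v; have [X Y] := XY v; rewrite [v]E; move: (v - plane_part i v) X Y => w X Y; rewrite !qBDr !qBZr qBvv.
  by have [-> _] := ho _ X Y; rewrite he hef; ring.
by have [_ ->] := ho _ X Y; rewrite hf polarC hef; ring.
Qed.

Lemma rad_restrict (P : pred 'I_g) :
  (forall i, ~~ P i -> rad (e i) /\ rad (f i)) ->
  forall v, q v = q (\sum_(i | P i) plane_part i v).
Proof.
move=> hP v; rewrite {1}[v]vec_sum (bigID P) /= addrC.
apply: (_ : rad (\sum_(i | ~~ P i) plane_part i v)).
elim/big_ind: _ => [w|u w|i /hP[h1 h2]]; first by rewrite add0r.
  exact: radD.
by apply: radD; apply: radZ.
Qed.

Lemma rad_restrict1 i : (forall j, j != i -> rad (e j) /\ rad (f j)) ->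
  forall v, q v = xc v i ^+ 2 * q (e i) + xc v i * yc v i * polar q (e i) (f i)
                  + yc v i ^+ 2 * q (f i).
Proof.
move=> h v; rewrite (rad_restrict (P := pred1 i) h) big_pred1_eq /plane_part.
by rewrite qD !(qZ hq) (qBZ hq) qBZr; ring.
Qed.

Lemma rad_restrict2 i j : i != j ->
  (forall k, k != i -> k != j -> rad (e k) /\ rad (f k)) ->
  forall v, q v = q (plane_part i v + plane_part j v).
Proof.
move=> nij h v; rewrite (rad_restrict (P := [pred k | (k == i) || (k == j)])).
  rewrite (bigD1 i) /= ?eqxx // (big_pred1 j) // => k /=.
  by case: (eqVneq k i) => [->|_] /=; rewrite ?andbF ?andbT ?(negPf nij).
by move=> k /=; rewrite negb_or => /andP[]; apply: h.
Qed.

End Quadratic.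

Section VeroneseMap.
Variables (R : comNzRingType) (g : nat).
Local Notation V := 'cV[R]_(g + g).
Implicit Types (u v w : V) (a : R).

Lemma spvZ a u : val (spv (a *: u)) = a ^+ 2 *: val (spv u).
Proof.
apply: sp_vec => w; rewrite -scalemxAl !tlogE omZl !scalerA; congr (_ *: _); ring.
Qed.

(** The identities [spvZ], [spv_polarD] and [spv_polarZ] say that v |-> spv v is
    itself quadratic; composed with an additive functional it gives a quadratic
    form. *)
Lemma spv_polarD u v w : spv (u + v + w) - spv (u + v) - spv w =
  (spv (u + w) - spv u - spv w) + (spv (v + w) - spv v - spv w).
Proof.
apply: val_inj; apply: sp_vec => z; rewrite /= !mulmxDl !mulNmx !tlogE !omDl.
by apply/matrixP=> p q; rewrite !mxE; ring.
Qed.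

Lemma spv_polarZ a u v : val (spv (a *: u + v) - spv (a *: u) - spv v) =
  a *: val (spv (u + v) - spv u - spv v).
Proof.
apply: sp_vec => z; rewrite -scalemxAl /= !mulmxDl !mulNmx !tlogE !omDl !omZl.
by apply/matrixP=> p q; rewrite !mxE; ring.
Qed.

Lemma val_muln (m : sp_lie R g) n : val (m *+ n) = n%:R *: val m.
Proof.
by elim: n => [|n IH]; rewrite ?scale0r // mulrS /= IH -natr1 addrC scalerDl scale1r.
Qed.

End VeroneseMap.

Section Forms.
Variables (R : finComNzRingType) (g : nat).
Local Notation V := 'cV[R]_(g + g).
Local Notation G := (Sp R g).
Local Notation M := (sp_lie R g).
Local Notation e := (basis_e R).
Local Notation f := (basis_f R).
Implicit Types (u v w : V) (i j k : 'I_g) (a b : R) (x y : G) (F : V -> R).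

(** A functional phi is required, and not only that F be quadratic, because the
    comparison with homology evaluates phi on the whole Lie algebra. *)
Definition form F := exists2 phi : M -> R,
  forall m n, phi (m + n) = phi m + phi n & forall v, F v = phi (spv v).

Lemma spv_conj x v : spv (x *m v) = sp_conj x (spv v).
Proof.
apply: val_inj; apply: sp_vec => u.
rewrite [LHS]tlogE /= -[RHS]mulmxA -[RHS]mulmxA tlogE -scalemxAr; congr (_ *: _).
by rewrite -[u in LHS](Sp1 u) -(mulgV x) SpM SpE.
Qed.

Lemma formD F1 F2 : form F1 -> form F2 -> form (fun v => F1 v + F2 v).
Proof.
move=> [p1 h1 E1] [p2 h2 E2]; exists (fun m => p1 m + p2 m) => [m n|v].
  by rewrite h1 h2; ring.
by rewrite E1 E2.
Qed.
Lemma formZ a F : form F -> form (fun v => a * F v).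
Proof.
move=> [p h E]; exists (fun m => a * p m) => [m n|v]; last by rewrite E.
by rewrite h mulrDr.
Qed.
Lemma eq_form F1 F2 : F1 =1 F2 -> form F1 -> form F2.
Proof. by move=> E [p h E1]; exists p => // v; rewrite -E. Qed.
Lemma form0 : form (fun=> 0).
Proof. by exists (fun=> 0) => // *; rewrite addr0. Qed.
Lemma form_comp x F : form F -> form (fun v => F (x *m v)).
Proof.
move=> [p h E]; exists (fun m => p (sp_conj x m)) => [m n|v]; last by rewrite E spv_conj.
by rewrite sp_conjD h.
Qed.
Lemma form_sum (I : Type) (s : seq I) (P : pred I) (F : I -> V -> R) :
  (forall t, form (F t)) -> form (fun v => \sum_(t <- s | P t) F t v).
Proof.
move=> h; elim: s => [|i s IH]; first by apply: eq_form form0 => v; rewrite big_nil.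
case: (boolP (P i)) => Pi; last by apply: eq_form IH => v; rewrite big_cons (negPf Pi).
by apply: eq_form (formD (h i) IH) => v; rewrite big_cons Pi.
Qed.

Lemma tlog_entries v i :
  [/\ tlog v (lshift g i) (rshift g i) = xc v i ^+ 2,
      tlog v (rshift g i) (rshift g i) = xc v i * yc v i
    & tlog v (rshift g i) (lshift g i) = - yc v i ^+ 2].
Proof.
have E p q : tlog v p q = om v (delta_mx q 0) * v p 0.
  have := congr1 (fun u : V => u p 0) (tlogE v (delta_mx q 0)).
  by rewrite -colE !mxE.
rewrite !E -/(e i) -/(f i) !(omC v) om_f om_e; split; rewrite -?/(xc v i) -?/(yc v i); ring.
Qed.

Lemma form_xx i : form (fun v => xc v i ^+ 2).
Proof.
exists (fun m : M => val m (lshift g i) (rshift g i)) => [m n|v]; first by rewrite mxE.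
by have [<-] := tlog_entries v i.
Qed.
Lemma form_xy i : form (fun v => xc v i * yc v i).
Proof.
exists (fun m : M => val m (rshift g i) (rshift g i)) => [m n|v]; first by rewrite mxE.
by have [_ <-] := tlog_entries v i.
Qed.
Lemma form_yy i : form (fun v => yc v i ^+ 2).
Proof.
exists (fun m : M => - val m (rshift g i) (lshift g i)) => [m n|v]; first by rewrite mxE opprD.
by have [_ _ h] := tlog_entries v i; rewrite /= h opprK.
Qed.

Lemma additive_muln (phi : M -> R) : (forall m n, phi (m + n) = phi m + phi n) ->
  forall m n, phi (m *+ n) = n%:R * phi m.
Proof.
move=> h m; have h0 : phi 0 = 0 by apply: (addrI (phi 0)); rewrite -h !addr0.
by elim=> [|n IH]; rewrite ?mulr0n ?mul0r // mulrS h IH -natr1; ring.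
Qed.

End Forms.

(** Scalars of Z/L are multiples of 1, so additive functionals are linear and
    inherit quadraticity from [spv]. *)
Lemma form_quadr (L g : nat) (F : 'cV['Z_L]_(g + g) -> 'Z_L) : (1 < L)%N -> form F -> quadr F.
Proof.
move=> hL [phi h E]; have hB m n : phi (m - n) = phi m - phi n.
  by apply/eqP; rewrite eq_sym subr_eq -h subrK.
have P u v : polar F u v = phi (spv (u + v) - spv u - spv v) by rewrite !hB /polar !E.
split=> [a u|u v w|a u v].
- rewrite !E -[a ^+ 2]natr_Zp -additive_muln //; congr (phi _); apply: val_inj.
  by rewrite val_muln natr_Zp spvZ.
- by rewrite !P -h spv_polarD.
rewrite !P -[a in RHS]natr_Zp -additive_muln //; congr (phi _); apply: val_inj.
by rewrite val_muln natr_Zp spv_polarZ.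
Qed.

(** * Cocycles with values in quadratic forms *)

Section Cocycles.
Variables (R : finComNzRingType) (g : nat).
Local Notation V := 'cV[R]_(g + g).
Local Notation G := (Sp R g).
Local Notation e := (basis_e R).
Local Notation f := (basis_f R).
Implicit Types (u v w : V) (i j k : 'I_g) (a b : R) (x y : G) (F : V -> R) (c : G -> V -> R).

(* The coefficient ring enters through these two facts only, which hold for
   Z/L by [form_quadr] and [Sp_generation]. *)
Hypothesis quadr_of_form : forall F, form F -> quadr F.
Hypothesis generation : forall K : {group G},
  (forall i, tv (e i) \in K) -> (forall i, tv (f i) \in K) ->
  (forall i j, i != j -> tv (e i + e j) \in K) -> K = [set: G] :> {set G}.

(** Right cocycles: c x v stands for the value at x^-1 of a crossed homomorphism
    to the module of forms.  This convention avoids inverses in all relations.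
    The scalar tau records a torsion condition on the values: tau = 2 for
    values killed by 2, and tau = 1 - 2h for values on which h inverts 2. *)
Record cocycle (tau : R) c : Prop := Cocycle {
  cM : forall x y v, c (x * y)%g v = c x (y *m v) + c y v;
  cF : forall x, form (c x);
  cT : forall x v, tau * c x v = 0 }.

Definition trivial c := exists2 F, form F & forall x v, c x v = F (x *m v) - F v.
Definition twist c F x v := c x v - (F (x *m v) - F v).
Definition vanish c x := forall v, c x v = 0.

Lemma formB F1 F2 : form F1 -> form F2 -> form (fun v => F1 v - F2 v).
Proof.
move=> h1 h2; apply: eq_form (formD h1 (formZ (-1) h2)) => v; by rewrite mulN1r.
Qed.

Lemma twist_cocycle tau c F : cocycle tau c -> form F -> (forall v, tau * F v = 0) ->
  cocycle tau (twist c F).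
Proof.
move=> [h1 h2 h3] hF tF; split=> [x y v|x|x v].
- by rewrite /twist h1 SpM; ring.
- by apply: formB => //; apply: formB => //; apply: form_comp.
by rewrite /twist !mulrBr h3 !tF; ring.
Qed.

Lemma twist_trivial c F : form F -> trivial (twist c F) -> trivial c.
Proof.
move=> hF [F1 h1 E]; exists (fun v => F v + F1 v); first exact: formD.
by move=> x v; have := E x v; rewrite /twist => /eqP; rewrite subr_eq => /eqP->; ring.
Qed.

Section Fixed.
Variables (tau : R) (c : G -> V -> R).
Hypothesis hc : cocycle tau c.

Lemma c_quadr x : quadr (c x). Proof. by apply: quadr_of_form; apply: (cF hc). Qed.

Lemma c1 v : c 1%g v = 0.
Proof. by apply: (addrI (c 1%g v)); rewrite addr0 -{1}[v]Sp1 -(cM hc) mulg1. Qed.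

Lemma vanishM x y : vanish c x -> vanish c y -> vanish c (x * y)%g.
Proof. by move=> h1 h2 v; rewrite (cM hc) h1 h2 addr0. Qed.
Lemma vanishX x n : vanish c x -> vanish c (x ^+ n)%g.
Proof.
by move=> h; elim: n => [|n IH]; [exact: c1 | rewrite expgS; exact: vanishM].
Qed.

Lemma vanish_conj x v w : vanish c x -> c (tv (x *m v)) (x *m w) = c (tv v) w.
Proof.
by move=> h; have := congr1 (c^~ w) (tv_conj x v); rewrite !(cM hc) !h add0r addr0.
Qed.

(** Evaluating c (x * y) = c (y * x) at a vector where one side simplifies is the
    main tool: [fixed_inv] uses a vector fixed by x, and [vanish_inv] an
    element y on which c vanishes. *)
Lemma fixed_inv x y v : (x * y = y * x)%g -> x *m v = v -> c x (y *m v) = c x v.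
Proof.
move=> hxy hv; have := congr1 (c^~ v) hxy; rewrite !(cM hc) hv addrC.
exact: addrI.
Qed.

Lemma vanish_inv x y v : (x * y = y * x)%g -> vanish c y -> c x (y *m v) = c x v.
Proof.
by move=> hxy hv; have := congr1 (c^~ v) hxy; rewrite !(cM hc) !hv add0r addr0.
Qed.

Lemma vanish_all : (forall i, vanish c (tv (e i))) -> (forall i, vanish c (tv (f i))) ->
  (forall i j, i != j -> vanish c (tv (e i + e j))) -> trivial c.
Proof.
move=> he hf hef; exists (fun=> 0); first exact: form0.
move=> x v; rewrite subrr.
pose K0 := [set x | [forall v, c x v == 0]].
have K0P y : reflect (vanish c y) (y \in K0).
  by rewrite inE; apply: (iffP forallP) => h w; apply/eqP; apply: h.
have gK : group_set K0.
  apply/group_setP; split=> [|y z /K0P hy /K0P hz]; apply/K0P; first exact: c1.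
  exact: vanishM.
have E : Group gK = [set: G] :> {set G}.
  by apply: generation => *; apply/K0P; [apply: he | apply: hf | apply: hef].
by apply/K0P; rewrite -[K0]/(gval (Group gK)) E inE.
Qed.

End Fixed.

(** The form F is minus the average of c over the powers of s, where n' is an
    inverse of the order n on the values of c.  Elements commuting with s on
    which c vanishes are not affected, so the process can be iterated over
    commuting elements. *)
Lemma normalize_one tau c s n n' : cocycle tau c -> (s ^+ n = 1)%g ->
  (forall a, tau * a = 0 -> n' * n%:R * a = a) ->
  exists F, [/\ form F, forall v, tau * F v = 0, vanish (twist c F) s &
    forall y, (s * y = y * s)%g -> vanish c y -> vanish (twist c F) y].
Proof.
move=> hc sn hn; pose F v := - n' * \sum_(k < n) c (s ^+ k)%g v.
exists F; split.
- by apply: formZ; apply: form_sum => k; apply: (cF hc).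
- move=> v; rewrite /F mulrCA mulr_sumr big1 ?mulr0 // => k _; exact: (cT hc).
- move=> v; rewrite /twist /F -mulrBr.
  have -> : \sum_(k < n) c (s ^+ k)%g (s *m v) = \sum_(k < n) (c (s ^+ k.+1)%g v - c s v).
    by apply: eq_bigr => k _; rewrite expgSr (cM hc) addrK.
  rewrite sumrB sumr_const card_ord.
  have -> : \sum_(k < n) c (s ^+ k.+1)%g v = \sum_(k < n) c (s ^+ k)%g v.
    case: n sn {hn F} => [|n] sn; first by rewrite !big_ord0.
    by rewrite big_ord_recr big_ord_recl /= sn expg0 addrC.
  have := hn (c s v) (cT hc s v); rewrite -[c s v *+ n]mulr_natl => h.
  have -> : c s v - - n' * (\sum_(k < n) c (s ^+ k)%g v - n%:R * c s v
     - \sum_(k < n) c (s ^+ k)%g v) = c s v - n' * n%:R * c s v by ring.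
  by rewrite h subrr.
move=> y hy vy v; rewrite /twist /F vy -mulrBr.
have hk (k : nat) : (s ^+ k * y = y * s ^+ k)%g by apply: commuteX2 (k) 1%N _.
rewrite (eq_bigr (fun k : 'I_n => c (s ^+ k)%g v)) ?subrr ?mulr0 ?subr0 // => k _.
exact: (vanish_inv hc _ (hk k) vy).
Qed.

Lemma normalize tau c (s : 'I_g -> G) n n' : cocycle tau c ->
  (forall i, s i ^+ n = 1)%g -> (forall i j, s i * s j = s j * s i)%g ->
  (forall a, tau * a = 0 -> n' * n%:R * a = a) ->
  exists F, [/\ form F, forall v, tau * F v = 0 & forall i, vanish (twist c F) (s i)].
Proof.
move=> hc sn ss hn.
suff H (l : seq 'I_g) : exists F, [/\ form F, forall v, tau * F v = 0 &
    forall i, i \in l -> vanish (twist c F) (s i)].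
  have [F [h1 h2 h3]] := H (enum 'I_g); exists F; split=> // i.
  by apply: h3; rewrite mem_enum.
elim: l => [|i l [F [h1 h2 h3]]].
  by exists (fun=> 0); split=> //; [exact: form0 | move=> v; rewrite mulr0].
have hc1 := twist_cocycle hc h1 h2.
have [F1 [k1 k2 k3 k4]] := normalize_one hc1 (sn i) hn.
exists (fun v => F v + F1 v); split.
- exact: formD.
- by move=> v; rewrite mulrDr h2 k2 addr0.
move=> j; rewrite inE => hj v.
have -> : twist c (fun v => F v + F1 v) (s j) v = twist (twist c F) F1 (s j) v.
  by rewrite /twist; ring.
case/orP: hj => [/eqP->|jl]; first exact: k3.
by apply: k4 => //; apply: h3.
Qed.

End Cocycles.

(** * Supports of the values of a normalized cocycle *)

Section Localization.
Variables (R : finComNzRingType) (g : nat).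
Local Notation V := 'cV[R]_(g + g).
Local Notation G := (Sp R g).
Local Notation e := (basis_e R).
Local Notation f := (basis_f R).
Implicit Types (u v w : V) (i j k : 'I_g) (a b : R) (x y : G) (F : V -> R).

Hypothesis hg : (2 < g)%N.
Hypothesis quadr_of_form : forall F, form F -> quadr F.

Lemma other_plane i j : exists2 k, k != i & k != j.
Proof.
have : (0 < #|~: [set i; j]|)%N.
  rewrite cardsCs setCK card_ord subn_gt0 (leq_ltn_trans _ hg) //.
  by rewrite cards2; case: (i != j).
case/card_gt0P=> k; rewrite !inE negb_or => /andP[]; by exists k.
Qed.

Lemma tv_comm_fixed x i : x *m e i = e i -> x *m f i = f i ->
  (x * tv (e i) = tv (e i) * x)%g /\ (x * tv (f i) = tv (f i) * x)%g.
Proof. by move=> h1 h2; rewrite !tv_conj h1 h2. Qed.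

Lemma rot_e i : rot R i *m e i = - f i.
Proof. by rewrite rotE; apply: vecP => k; rewrite !coordE ?eqxx /=; ring. Qed.
Lemma rot_f i : rot R i *m f i = e i.
Proof. by rewrite rotE; apply: vecP => k; rewrite !coordE ?eqxx /=; ring. Qed.
Lemma rot_fix i v : xc v i = 0 -> yc v i = 0 -> rot R i *m v = v.
Proof. by move=> h1 h2; rewrite rotE h1 h2 subrr addr0 !scale0r subrr addr0. Qed.
Lemma ord3_e i : ord3 R i *m e i = - e i - f i.
Proof. by rewrite ord3E; apply: vecP => k; rewrite !coordE ?eqxx /=; ring. Qed.
Lemma ord3_f i : ord3 R i *m f i = e i.
Proof. by rewrite ord3E; apply: vecP => k; rewrite !coordE ?eqxx /=; ring. Qed.
Lemma ord3_fix i v : xc v i = 0 -> yc v i = 0 -> ord3 R i *m v = v.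
Proof. by move=> h1 h2; rewrite ord3E h1 h2 mulr0 subrr addr0 !scale0r subrr addr0. Qed.

Lemma comm_rot x i : (x * tv (e i) = tv (e i) * x)%g -> (x * tv (f i) = tv (f i) * x)%g ->
  (x * rot R i = rot R i * x)%g.
Proof. by move=> h1 h2; rewrite rot_def; apply: commuteM => //; apply: commuteM. Qed.
Lemma comm_ord3 x i : (x * tv (e i) = tv (e i) * x)%g -> (x * tv (f i) = tv (f i) * x)%g ->
  (x * ord3 R i = ord3 R i * x)%g.
Proof. by move=> h1 h2; rewrite ord3_def expgS expg1; do 2! apply: commuteM => //. Qed.

Lemma rot_comm i j : (rot R i * rot R j = rot R j * rot R i)%g.
Proof.
case: (eqVneq i j) => [->//|nij].
have nji : (j == i) = false by rewrite eq_sym (negPf nij).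
by apply: comm_rot; rewrite tv_conj rot_fix ?coordE ?(negPf nij) ?nji.
Qed.
Lemma ord3_comm i j : (ord3 R i * ord3 R j = ord3 R j * ord3 R i)%g.
Proof.
case: (eqVneq i j) => [->//|nij].
have nji : (j == i) = false by rewrite eq_sym (negPf nij).
by apply: comm_ord3; rewrite tv_conj ord3_fix ?coordE ?(negPf nij) ?nji.
Qed.

Variables (tau : R) (c : G -> V -> R).
Hypothesis hc : cocycle tau c.

Let cq x : quadr (c x). Proof. exact: (c_quadr quadr_of_form hc). Qed.

(** Commuting with these two transvections is commuting with the subgroup they
    generate in SL_2 of the i-th plane, which contains rot i and ord3 i. *)
Definition ortho := forall x i,
  (x * tv (e i) = tv (e i) * x)%g -> (x * tv (f i) = tv (f i) * x)%g ->
  forall v, xc v i = 0 -> yc v i = 0 ->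
  polar (c x) (e i) v = 0 /\ polar (c x) (f i) v = 0.

Definition in_plane i x := forall j, j != i -> x *m e j = e j /\ x *m f j = f j.

(** With these radicals c x becomes a binary form, by [rad_restrict1]. *)
Definition plane_supp := forall i x, in_plane i x -> forall j, j != i ->
  rad (c x) (e j) /\ rad (c x) (f j).

Lemma polar_inv x s u v : (x * s = s * x)%g -> vanish c s ->
  polar (c x) (s *m u) (s *m v) = polar (c x) u v.
Proof.
move=> h hs; rewrite /polar -mulmxDr !(vanish_inv hc _ h hs) //.
Qed.

Lemma tau_polar x u v : tau * polar (c x) u v = 0.
Proof. by rewrite /polar !mulrBr !(cT hc) !subr0. Qed.

Section Odd.
Hypothesis odd_tau : forall a, tau * a = 0 -> 2%:R * a = 0 -> a = 0.
Hypothesis vrot : forall i, vanish c (rot R i).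

(** The polar form is invariant under the rotation of the i-th plane, whose
    square is - 1 there and 1 on the other planes; so twice it vanishes. *)
Lemma odd_ortho : ortho.
Proof.
move=> x i h1 h2 v v1 v2; have h := comm_rot h1 h2.
have := polar_inv (e i) v h (vrot i); have := polar_inv (f i) v h (vrot i).
rewrite rot_e rot_f (rot_fix v1 v2) (qBN (cq x)) => E1 E2.
have Z : polar (c x) (f i) v = 0.
  apply: odd_tau; first exact: tau_polar.
  by rewrite mulr_natl mulr2n -[X in X + _]E1 -E2 addNr.
by rewrite E1 Z.
Qed.

(** On vectors fixed by x the form c x is invariant under everything commuting
    with x, in particular under SL_2 of the j-th plane; no
    nonzero binary quadratic form is, if 2 acts injectively on its values. *)
Lemma odd_plane : plane_supp.
Proof.
move=> i x hx j nj; have [xe xf] := hx j nj; have [h1 h2] := tv_comm_fixed xe xf.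
have A : c x (e j + f j) = c x (f j).
  have <- : tv (e j) *m f j = e j + f j by rewrite tvE omE coordE eqxx scale1r addrC.
  exact: (fixed_inv hc h1 xf).
have B : c x (e j - f j) = c x (e j).
  have <- : tv (f j) *m e j = e j - f j by rewrite tvE omE coordE eqxx scaleN1r.
  exact: (fixed_inv hc h2 xe).
have C : c x (e j) = c x (f j).
  by rewrite -[in LHS]rot_f (vanish_inv hc _ (comm_rot h1 h2) (vrot j)).
rewrite qD in A; rewrite qD (qN (cq x)) (qBNr (cq x)) in B.
have D : polar (c x) (e j) (f j) = c x (f j) by apply: (eq_of_diff (esym B)); ring.
have Z : c x (f j) = 0.
  apply: odd_tau; first exact: (cT hc).
  by move: A; rewrite C D => A; apply: (eq_of_diff A); ring.
by apply: (rad_plane (cq x)); rewrite ?C ?D ?Z //; apply: odd_ortho.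
Qed.
End Odd.

Section Even.
Hypothesis even_tau : forall x v, 2%:R * c x v = 0.
Hypothesis vord3 : forall i, vanish c (ord3 R i).

(** For s of order 3 one has 1 + s + s^2 = 0 on the i-th plane, so three times the
    polar form vanishes. *)
Lemma even_ortho : ortho.
Proof.
move=> x i h1 h2 v v1 v2; have h := comm_ord3 h1 h2.
have := polar_inv (e i) v h (vord3 i); have := polar_inv (f i) v h (vord3 i).
rewrite ord3_e ord3_f (ord3_fix v1 v2) (qBD (cq x)) !(qBN (cq x)) => E1 E2.
have T : 2%:R * polar (c x) (f i) v = 0 by rewrite /polar !mulrBr !even_tau !subr0.
have Z : polar (c x) (f i) v = 0.
  by rewrite E1 in E2; apply: (eq_of_diff2 (esym E2) (esym T)); ring.
by rewrite E1 Z.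
Qed.

(** Modulo 2 the binary form x^2 + x y + y^2 is invariant under SL_2, so a single
    other plane gives nothing.  A second one does: invariance under the
    transvection along e j + e k, evaluated at f j, kills the value at e k. *)
Lemma even_plane : plane_supp.
Proof.
move=> i x hx k nk; have [j nji njk] := other_plane i k.
have nkj : (k == j) = false by rewrite eq_sym (negPf njk).
have [xej xfj] := hx j nji; have [xek xfk] := hx k nk.
have [h1 h2] := tv_comm_fixed xej xfj; have [k1 k2] := tv_comm_fixed xek xfk.
have sj := comm_ord3 h1 h2; have sk := comm_ord3 k1 k2.
have A : c x (e j + f j + e k) = c x (f j).
  have <- : tv (e j + e k) *m f j = e j + f j + e k.
    by rewrite tvE !omE eqxx nkj addr0 scale1r addrA [f j + _]addrC.
  apply: (fixed_inv hc) => //; by rewrite tv_conj mulmxDr xej xek.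
have B : c x (e j) = c x (f j) by rewrite -[in LHS]ord3_f (vanish_inv hc _ sj (vord3 j)).
have C : c x (e j + f j) = c x (e j).
  by rewrite -(qN (cq x)) opprD -ord3_e (vanish_inv hc _ sj (vord3 j)).
have B' : c x (e k) = c x (f k) by rewrite -[in LHS]ord3_f (vanish_inv hc _ sk (vord3 k)).
have C' : c x (e k + f k) = c x (e k).
  by rewrite -(qN (cq x)) opprD -ord3_e (vanish_inv hc _ sk (vord3 k)).
have Z : c x (e k) = 0.
  have O u : xc u k = 0 -> yc u k = 0 -> polar (c x) (e k) u = 0.
    by move=> u1 u2; have [] := even_ortho k1 k2 u1 u2.
  move: A; rewrite qD polarC O ?C ?B ?addr0; first by move=> A; apply: (eq_of_diff A); ring.
    by rewrite !coordE nkj addr0.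
  by rewrite !coordE nkj addr0.
apply: (rad_plane (cq x)); rewrite -?B' ?Z //; first exact: even_ortho.
by rewrite /polar C' -B' Z !subr0.
Qed.
End Even.

Section Common.
Hypothesis ho : ortho.
Hypothesis hp : plane_supp.

Lemma in_plane_e i : in_plane i (tv (e i)).
Proof.
move=> j nj; rewrite !tvE !om_e !coordE eq_sym (negPf nj) !scale0r !addr0; by split.
Qed.
Lemma in_plane_f i : in_plane i (tv (f i)).
Proof.
move=> j nj; rewrite !tvE !om_f !coordE eq_sym (negPf nj) !oppr0 !scale0r !addr0; by split.
Qed.

(** The transvections along e i and e i + e j commute, and f j is fixed by the
    first and mapped by the second to f j + e i + e j, where c (tv (e i)) takes
    the same value as at e i. *)
Lemma ce_e i : c (tv (e i)) (e i) = 0.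
Proof.
have [j nj _] := other_plane i i; have nij : i != j by rewrite eq_sym.
have hs := hp (@in_plane_e i); have [re rf] := hs j nj.
have C : (tv (e i) * tv (e i + e j) = tv (e i + e j) * tv (e i))%g.
  by apply: tv_comm; rewrite om_e !coordE addr0.
have := fixed_inv hc C (proj2 (in_plane_e nj)).
have -> : tv (e i + e j) *m f j = f j + (e j + e i).
  by rewrite tvE !omE eqxx (negPf nij) add0r scale1r [e i + _]addrC.
by rewrite rf re => ->; apply: (rad_q (cq _)).
Qed.

Lemma cf_f i : c (tv (f i)) (f i) = 0.
Proof.
have [j nj _] := other_plane i i; have nij : i != j by rewrite eq_sym.
have hs := hp (@in_plane_f i); have [re rf] := hs j nj.
have C : (tv (f i) * tv (f i + f j) = tv (f i + f j) * tv (f i))%g.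
  by apply: tv_comm; rewrite om_f !coordE addr0 oppr0.
have := fixed_inv hc C (proj1 (in_plane_f nj)).
have -> : tv (f i + f j) *m e j = e j + (- f j + - f i).
  by rewrite tvE !omE eqxx (negPf nij) oppr0 add0r scaleN1r opprD [- f i + _]addrC.
by rewrite re (radN (cq _) rf) (qN (cq _)) => ->; apply: (rad_q (cq _)).
Qed.

Lemma ceE i v : c (tv (e i)) v =
  xc v i * yc v i * polar (c (tv (e i))) (e i) (f i) + yc v i ^+ 2 * c (tv (e i)) (f i).
Proof.
rewrite (rad_restrict1 (cq _) (hp (@in_plane_e i))) ce_e; ring.
Qed.
Lemma cfE i v : c (tv (f i)) v =
  xc v i ^+ 2 * c (tv (f i)) (e i) + xc v i * yc v i * polar (c (tv (f i))) (e i) (f i).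
Proof.
rewrite (rad_restrict1 (cq _) (hp (@in_plane_f i))) cf_f; ring.
Qed.

(** The element h conjugates tv (e i) to tv (e i + e j) and fixes all vectors
    orthogonal to the planes i and j.  On such fixed vectors c is additive in
    the group element, so c takes there the same value on both transvections. *)
Lemma pair_supp i j k : i != j -> k != i -> k != j ->
  rad (c (tv (e i + e j))) (e k) /\ rad (c (tv (e i + e j))) (f k).
Proof.
move=> nij nki nkj; set x := tv (e i + e j).
have nji : (j == i) = false by rewrite eq_sym (negPf nij).
pose h : G := ((tv (f i))^-1 * tv (e j - f i))%g.
have hh : (x * h = h * tv (e i))%g.
  rewrite tv_conj; congr (tv _ * _)%g.
  rewrite SpM tvE tvV !omE !eqxx ?(negPf nij) ?nji.
  by apply: vecP => l; rewrite !coordE /=; ring.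
have hu u : xc u i = 0 -> yc u i = 0 -> xc u j = 0 -> yc u j = 0 -> h *m u = u.
  by move=> u1 u2 u3 u4; rewrite SpM tvE tvV !omE ?u1 ?u2 ?u3 ?u4; apply: vecP => l; rewrite !coordE /=; ring.
have E u : xc u i = 0 -> yc u i = 0 -> xc u j = 0 -> yc u j = 0 -> c x u = c (tv (e i)) u.
  move=> u1 u2 u3 u4; have := congr1 (c^~ u) hh; rewrite !(cM hc) hu //.
  have -> : tv (e i) *m u = u by rewrite tvE om_e u2 scale0r addr0.
  by rewrite addrC; apply: addrI.
have [re rf] := hp (@in_plane_e i) nki.
have nik : (i == k) = false by rewrite eq_sym (negPf nki).
have njk : (j == k) = false by rewrite eq_sym (negPf nkj).
have Ee : c x (e k) = 0 by rewrite E ?coordE ?nik ?njk // (rad_q (cq _)).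
have Ef : c x (f k) = 0 by rewrite E ?coordE ?nik ?njk // (rad_q (cq _)).
apply: (rad_plane (cq x)) => //.
  apply: ho; rewrite /x; apply: tv_comm; rewrite ?omE ?om_e ?coordE ?(negPf nki) ?(negPf nkj) ?nik ?njk /=; ring.
rewrite /polar Ee Ef !subr0 E ?coordE ?nik ?njk ?addr0 //.
by rewrite re (rad_q (cq _) rf).
Qed.

End Common.
End Localization.

(** * Transvections along sums of two basis vectors *)

Section PairTransvections.
Variables (R : finComNzRingType) (g : nat).
Local Notation V := 'cV[R]_(g + g).
Local Notation G := (Sp R g).
Local Notation e := (basis_e R).
Local Notation f := (basis_f R).
Implicit Types (u v w : V) (i j k : 'I_g) (a b : R) (x y : G) (F : V -> R) (c : G -> V -> R).

Hypothesis quadr_of_form : forall F, form F -> quadr F.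
Section LongRootsVanish.
Variables (tau : R) (c : G -> V -> R).
Hypothesis hc : cocycle tau c.
Hypothesis ho : ortho c.
Hypothesis hp : plane_supp c.
Hypothesis ve : forall i, vanish c (tv (e i)).
Hypothesis vf : forall i, vanish c (tv (f i)).

Let cq x : quadr (c x). Proof. exact: (c_quadr quadr_of_form hc). Qed.

Lemma vanish_rot i : vanish c (rot R i).
Proof. by rewrite rot_def; apply: (vanishM hc (vanishM hc (ve i) (vf i)) (ve i)). Qed.

Section Pair.
Variables i j : 'I_g.
Local Notation r := (c (tv (e i + e j))).

Lemma pair_inv v : r (v + yc v i *: e i) = r v.
Proof.
rewrite -om_e -tvE (vanish_inv hc _ _ (ve i)) //.
by apply: tv_comm; rewrite !omE addr0.
Qed.

Lemma pair_ef : polar r (e i) (f i) = - r (e i).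
Proof.
have := pair_inv (f i); rewrite !coordE eqxx scale1r [f i + _]addrC qD => A.
by apply: (eq_of_diff A); ring.
Qed.
Lemma pair_inv1 u : yc u i = 0 -> polar r (e i) (f i + u) = - r (e i).
Proof.
move=> h; have := pair_inv (f i + u); rewrite !coordE eqxx h addr0 scale1r [f i + u + _]addrC (qD _ (e i)) => A.
by apply: (eq_of_diff A); ring.
Qed.
Lemma pair_perp u : yc u i = 0 -> polar r (e i) u = 0.
Proof.
by move=> h; have := pair_inv1 h; rewrite (qBDr (cq _)) pair_ef => A; apply: (eq_of_diff A); ring.
Qed.
Lemma pair_2e : 2%:R * r (e i) = 0.
Proof. by rewrite -(qBvv (cq _)) pair_perp ?coordE. Qed.

End Pair.

Section Pair2.
Variables i j : 'I_g.
Hypothesis nij : i != j.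
Local Notation r := (c (tv (e i + e j))).
Let nji : j != i. Proof. by rewrite eq_sym. Qed.

Lemma pair_swap : polar r (f i) (e j) = 0.
Proof. by rewrite polarC addrC pair_perp // coordE (negPf nji). Qed.

(** The square of the rotation of the j-th plane maps e i + e j to e i - e j, so
    that c (tv (e i - e j)) is determined by r; the relation used is
    t_{e_i + e_j} t_{e_i - e_j} = t_{e_i}^2 t_{e_j}^2, evaluated at f i. *)
Lemma pair_e_f : r (e j) + 2%:R * r (f i) = 0.
Proof.
pose z := (rot R j ^+ 2)%g.
have vz : vanish c z by apply: (vanishX hc); apply: vanish_rot.
have zE : z *m (e i + e j) = e i - e j.
  by rewrite rot2E; apply: vecP => k; rewrite !coordE ?eqxx ?(negPf nji) /=; ring.
have zf : z *m f i = f i.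
  by rewrite rot2E; apply: vecP => k; rewrite !coordE ?(negPf nji) /=; ring.
have H := vanish_conj hc (e i + e j) (f i) vz; rewrite zE zf in H.
have E : (tv (e i + e j) * tv (e i - e j) = tv (e i) ^+ 2 * tv (e j) ^+ 2)%g.
  apply: Sp_ext => v; rewrite (SpM (tv (e i + e j))) (SpM (tv (e i) ^+ 2)%g) !tvE !tvX !omE; apply: vecP => k; rewrite !coordE; ring.
have Ev : vanish c (tv (e i + e j) * tv (e i - e j))%g.
  by rewrite E; apply: (vanishM hc); apply: (vanishX hc); apply: ve.
have := Ev (f i); rewrite (cM hc) H tvE !omE eqxx (negPf nji) subr0 scale1r.
have -> : f i + (e i - e j) = e i + (f i - e j) by rewrite addrCA.
rewrite qD (@pair_inv1 i j (- e j)) ?coordE ?oppr0 // qD (qN (cq _)) (qBNr (cq _)).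
by rewrite pair_swap => A; apply: (eq_of_diff A); ring.
Qed.

(** The transvections along e i + e j and f j - f i commute.  The element k, a
    product of rotations, maps the first axis to the second one, so c on the
    second transvection is also determined by r. *)
Lemma pair_long : r (e i) = 0 -> r (e j) = 0 -> polar r (f i) (f j) = r (f i) + r (f j).
Proof.
move=> ri rj.
pose k := (rot R i * rot R j ^+ 3)%g.
have vk : vanish c k by apply: (vanishM hc); last apply: (vanishX hc); apply: vanish_rot.
have r3 u : (rot R j ^+ 3)%g *m u = u - (xc u j + yc u j) *: e j + (xc u j - yc u j) *: f j.
  rewrite expgSr SpM rot2E [rot R j *m u]rotE; apply: vecP => l.
    by rewrite !coordE ?eqxx /=; ring.
  by rewrite !coordE ?eqxx /=; ring.
have nij' : (i == j) = false by rewrite (negPf nij).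
have kE : k *m (e i + e j) = f j - f i.
  rewrite SpM r3 rotE; apply: vecP => l; rewrite !coordE ?eqxx ?(negPf nji) ?nij' /=; ring.
have kv : k *m (f i - f j - e i) = f i + (e i + e j).
  rewrite SpM r3 rotE; apply: vecP => l; rewrite !coordE ?eqxx ?(negPf nji) ?nij' /=; ring.
have ke : k *m (- e i) = f i.
  rewrite SpM r3 rotE; apply: vecP => l; rewrite !coordE ?eqxx ?(negPf nji) ?nij' /=; ring.
have C : (tv (f j - f i) * tv (e i + e j) = tv (e i + e j) * tv (f j - f i))%g.
  by apply: tv_comm; rewrite !omE !eqxx nij' (negPf nji) /=; ring.
have fix_f : tv (f j - f i) *m f i = f i.
  by rewrite tvE !omE !oppr0 addr0 scale0r addr0.
have := fixed_inv hc C fix_f.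
have -> : tv (e i + e j) *m f i = f i + (e i + e j).
  by rewrite tvE !omE eqxx (negPf nji) addr0 scale1r.
rewrite -kE -kv (vanish_conj hc _ _ vk) -{2}ke (vanish_conj hc _ _ vk).
rewrite (qN (cq _)) ri [f i - f j + _]addrC qD (qBN (cq _)) (qN (cq _)) (@pair_inv1 i j) ?coordE ?(negPf nij) ?oppr0 //.
rewrite ri qD (qN (cq _)) (qBNr (cq _)) => A; apply: (eq_of_diff (esym A)); ring.
Qed.

Lemma pairE : r (e i) = 0 -> r (e j) = 0 -> forall v,
  r v = yc v i ^+ 2 * r (f i) + yc v j ^+ 2 * r (f j)
        + yc v i * yc v j * (r (f i) + r (f j)).
Proof.
move=> ri rj v.
have radi : rad r (e i).
  apply: (radP ri) => u.
  have -> : u = yc u i *: f i + (u - yc u i *: f i) by rewrite addrC subrK.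
  rewrite (qBDr (cq _)) (qBZr (cq _)) pair_ef ri // pair_perp //; first by ring.
  by rewrite !coordE eqxx /=; ring.
have radj : rad r (e j).
  apply: (radP rj) => u.
  have -> : u = yc u j *: f j + (u - yc u j *: f j) by rewrite addrC subrK.
  rewrite (qBDr (cq _)) (qBZr (cq _)) [e i + e j]addrC pair_ef // pair_perp //.
    by rewrite addrC [e j + e i]addrC rj; ring.
  by rewrite !coordE eqxx /=; ring.
rewrite (rad_restrict2 (cq _) nij (fun k ki kj => pair_supp quadr_of_form hc ho hp nij ki kj)) /plane_part.
rewrite -addrA (radZ (cq _) _ radi) addrCA (radZ (cq _) _ radj).
by rewrite qD !(qZ (cq _)) (qBZ (cq _)) (qBZr (cq _)) pair_long //; ring.
Qed.

End Pair2.
End LongRootsVanish.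
End PairTransvections.

(** * Triviality of cocycles *)

Section Conclusion.
Variables (R : finComNzRingType) (g : nat).
Local Notation V := 'cV[R]_(g + g).
Local Notation G := (Sp R g).
Local Notation e := (basis_e R).
Local Notation f := (basis_f R).
Implicit Types (u v w : V) (i j k : 'I_g) (a b : R) (x y : G) (F : V -> R) (c : G -> V -> R).

Hypothesis hg : (2 < g)%N.
Hypothesis quadr_of_form : forall F, form F -> quadr F.
Hypothesis generation : forall K : {group G},
  (forall i, tv (e i) \in K) -> (forall i, tv (f i) \in K) ->
  (forall i j, i != j -> tv (e i + e j) \in K) -> K = [set: G] :> {set G}.

Definition plane_sum (Q : 'I_g -> R -> R -> R) v : R := \sum_i Q i (xc v i) (yc v i).

Lemma plane_sum1 Q i v w :
  (forall k, k != i -> xc w k = xc v k /\ yc w k = yc v k) ->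
  plane_sum Q w - plane_sum Q v = Q i (xc w i) (yc w i) - Q i (xc v i) (yc v i).
Proof.
move=> h; rewrite /plane_sum (bigD1 i) //= [X in _ - X](bigD1 i) //=.
rewrite (eq_bigr (fun k => Q k (xc v k) (yc v k))); first by ring.
by move=> k /h[-> ->].
Qed.

Lemma plane_sum2 Q i j v w : i != j ->
  (forall k, k != i -> k != j -> xc w k = xc v k /\ yc w k = yc v k) ->
  plane_sum Q w - plane_sum Q v =
    (Q i (xc w i) (yc w i) - Q i (xc v i) (yc v i)) +
    (Q j (xc w j) (yc w j) - Q j (xc v j) (yc v j)).
Proof.
move=> nij h; have nji : j != i by rewrite eq_sym.
rewrite /plane_sum (bigD1 i) //= [X in _ - X](bigD1 i) //=.
rewrite (bigD1 j) //= [X in _ - (_ + X)](bigD1 j) //=.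
rewrite (eq_bigr (fun k => Q k (xc v k) (yc v k))); first by ring.
by move=> k /andP[h1 h2]; have [-> ->] := h k h1 h2.
Qed.

Section OddStage.
Variables (tau : R) (h : R).
Hypothesis tauE : tau = 1 - 2%:R * h.

Let odd_tau a : tau * a = 0 -> 2%:R * a = 0 -> a = 0.
Proof.
rewrite tauE => h1 h2; have -> : a = (1 - 2%:R * h) * a + h * (2%:R * a) by ring.
by rewrite h1 h2 mulr0 addr0.
Qed.

(** Since c vanishes on the rotation t_e t_f t_e, the two coefficients of
    c (tv (e i)) are related by [al_ef], which makes c (tv (e i)) the coboundary
    of al i times x^2 + y^2.  This form is invariant under the rotation, so
    subtracting it preserves the normalization, and then c vanishes on all
    tv (e i) and tv (f i).  The form c (t_{e_i + e_j})
    is then determined by values that are killed by 2, hence zero. *)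
Lemma odd_trivial_rot c : cocycle tau c -> (forall i, vanish c (rot R i)) -> trivial c.
Proof.
move=> hc vr; have ho := odd_ortho quadr_of_form hc odd_tau vr.
have hp := odd_plane quadr_of_form hc odd_tau vr.
have cq x := c_quadr quadr_of_form hc x.
have tf_rot c' : cocycle tau c' -> (forall i, vanish c' (rot R i)) ->
    forall i v, c' (tv (f i)) (rot R i *m v) = c' (tv (e i)) v.
  by move=> hc' vr' i v; rewrite -(vanish_conj hc' (e i) v (vr' i)) rot_e tvN.
pose al i := c (tv (f i)) (e i).
have al_f i : c (tv (e i)) (f i) = al i by rewrite -(tf_rot _ hc vr) rot_f.
have al_ef i : polar (c (tv (e i))) (e i) (f i) = 2%:R * al i.
  have := vr i (e i); rewrite rot_def (cM hc) (cM hc).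
  rewrite ![tv (e i) *m e i]tvE omvv scale0r addr0 (ce_e hg quadr_of_form hc hp) addr0.
  rewrite tvE om_f !coordE eqxx scaleN1r qD (qN (cq _)) (qBNr (cq _)).
  by rewrite (ce_e hg quadr_of_form hc hp) al_f => A; apply: (eq_of_diff (esym A)); rewrite /al; ring.
pose F := plane_sum (fun i a b => al i * (a ^+ 2 + b ^+ 2)).
have hF : form F.
  by apply: form_sum => i; apply: formZ; apply: formD; [exact: form_xx | exact: form_yy].
have tF v : tau * F v = 0.
  by rewrite mulr_sumr big1 // => i _; rewrite mulrA (cT hc) mul0r.
have hc' := twist_cocycle hc hF tF.
have vr' i : vanish (twist c F) (rot R i).
  move=> v; rewrite /twist vr /F (@plane_sum1 _ i).
    by rewrite rotE !coordE eqxx /=; ring.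
  by move=> k nk; rewrite rotE !coordE (negPf nk) /=; split; ring.
have ve' i : vanish (twist c F) (tv (e i)).
  move=> v; rewrite /twist /F (@plane_sum1 _ i).
    by rewrite (ceE hg quadr_of_form hc hp) tvE !omE eqxx al_ef al_f /=; ring.
  by move=> k nk; rewrite tvE !omE (negPf nk) /=; split; ring.
have vf' i : vanish (twist c F) (tv (f i)).
  move=> v; have -> : v = rot R i *m ((rot R i)^-1%g *m v) by rewrite -SpM mulgV Sp1.
  by rewrite (tf_rot _ hc' vr') ve'.
apply: (twist_trivial hF).
have ho' := odd_ortho quadr_of_form hc' odd_tau vr'.
have hp' := odd_plane quadr_of_form hc' odd_tau vr'.
apply: (vanish_all generation hc') => // i j nij.
have nji : j != i by rewrite eq_sym.
have Z x v : 2%:R * twist c F x v = 0 -> twist c F x v = 0 by apply: odd_tau (cT hc' _ _).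
have ri : twist c F (tv (e i + e j)) (e i) = 0 by apply: Z; apply: (pair_2e quadr_of_form hc' ve').
have rj : twist c F (tv (e i + e j)) (e j) = 0.
  by rewrite addrC; apply: Z; apply: (pair_2e quadr_of_form hc' ve').
have rfi : twist c F (tv (e i + e j)) (f i) = 0.
  by apply: Z; have := pair_e_f quadr_of_form hc' ve' vf' nij; rewrite rj add0r.
have rfj : twist c F (tv (e i + e j)) (f j) = 0.
  by apply: Z; have := pair_e_f quadr_of_form hc' ve' vf' nji; rewrite addrC [e j + _]addrC ri addr0.
by move=> v; rewrite (pairE quadr_of_form hc' ho' hp' ve' vf' nij) // rfi rfj; ring.
Qed.

Lemma odd_trivial c : cocycle tau c -> trivial c.
Proof.
move=> hc; have [|F [h1 h2 h3]] := normalize (n' := h ^+ 2) hc (@rot4 R g) (@rot_comm R g).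
  move=> a; rewrite tauE => ha.
  (* On the values of c the inverse of 2 is h, so that of 4 is h ^+ 2. *)
  have -> : h ^+ 2 * 4%:R * a = a - (1 + 2%:R * h) * ((1 - 2%:R * h) * a) by ring.
  by rewrite ha mulr0 subr0.
by apply: (twist_trivial h1); apply: odd_trivial_rot => //; apply: twist_cocycle.
Qed.

End OddStage.

Section EvenStage.
Variable m : nat.
Hypothesis m_odd : odd m.
Hypothesis char2m : (2 * m)%:R = 0 :> R.

Lemma even_shift (q : V -> R) (a : R) u w : quadr q -> (forall v, 2%:R * q v = 0) ->
  q (w + (2%:R * a) *: u) = q w.
Proof.
move=> hq h2; rewrite qD (qZ hq) (qBZr hq).
have P : 2%:R * polar q w u = 0 by rewrite /polar !mulrBr !h2 !subr0.
have -> : q w + (2%:R * a) ^+ 2 * q u + 2%:R * a * polar q w u =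
   q w + 2%:R * a ^+ 2 * (2%:R * q u) + a * (2%:R * polar q w u) by ring.
by rewrite h2 P !mulr0 !addr0.
Qed.

Section Transvection.
Variable c : G -> V -> R.
Hypothesis hc : cocycle 2%:R c.

(** A form with values killed by 2 is invariant under tv u ^+ 2, so c of the m-th
    power of tv u ^+ 2 is m times c (tv u ^+ 2).  As tv u has order
    dividing 2m and m is odd, the latter vanishes. *)
Lemma even_tv_sq u w : c (tv u) (tv u *m w) + c (tv u) w = 0.
Proof.
pose P v := c (tv u ^+ 2)%g v.
have PE v : P v = c (tv u) (tv u *m v) + c (tv u) v by rewrite /P expgS expg1 (cM hc).
have cq := c_quadr quadr_of_form hc (tv u ^+ 2)%g.
have Pn n v : c ((tv u ^+ 2) ^+ n)%g v = n%:R * P v.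
  elim: n v => [|n IH] v; first by rewrite expg0 (c1 hc) mul0r.
  rewrite expgSr (cM hc) IH -/(P v) tvX /P (even_shift _ _ _ cq (cT hc _)) -natr1 -/(P v); ring.
have : c ((tv u ^+ 2) ^+ m)%g w = 0.
  rewrite -expgM; have -> : (tv u ^+ (2 * m) = 1)%g.
    by apply: Sp_ext => v; rewrite tvX char2m mul0r scale0r addr0 Sp1.
  exact: (c1 hc).
rewrite Pn -PE -(odd_double_half m) m_odd add1n -natr1 -muln2 natrM => A.
have B : 2%:R * P w = 0 by apply: (cT hc).
have C : m./2%:R * (2%:R * P w) = 0 by rewrite B mulr0.
by apply: (eq_of_diff2 A (esym C)); ring.
Qed.

End Transvection.

(** [even_tv_sq] removes the mixed coefficients of c (tv (e i)) and c (tv (f i));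
    vanishing on the element of order 3 removes the remaining two. *)
Lemma even_long_roots c : cocycle 2%:R c -> (forall i, vanish c (ord3 R i)) ->
  (forall i, vanish c (tv (e i))) /\ (forall i, vanish c (tv (f i))).
Proof.
move=> hc vr; have T x v := cT hc x v.
have hp := even_plane hg quadr_of_form hc T vr.
have cq x := c_quadr quadr_of_form hc x.
have be i : polar (c (tv (e i))) (e i) (f i) = 0.
  have := even_tv_sq hc (e i) (f i).
  rewrite tvE om_e coordE eqxx scale1r addrC [f i + _]addrC qD (ce_e hg quadr_of_form hc hp) => A.
  by apply: (eq_of_diff2 A (esym (T (tv (e i)) (f i)))); ring.
have bf i : polar (c (tv (f i))) (e i) (f i) = 0.
  have := even_tv_sq hc (f i) (e i).
  rewrite tvE om_f coordE eqxx scaleN1r qD (qN (cq _)) (qBNr (cq _)) (cf_f hg quadr_of_form hc hp) => A.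
  by apply: (eq_of_diff2 (esym A) (T (tv (f i)) (e i))); ring.
have rho i v : c (tv (e i) * tv (f i))%g v =
    (yc v i - xc v i) ^+ 2 * c (tv (e i)) (f i) + xc v i ^+ 2 * c (tv (f i)) (e i).
  rewrite (cM hc) (ceE hg quadr_of_form hc hp) (cfE hg quadr_of_form hc hp) be bf tvE !omE eqxx /=; ring.
have ord i v : c (tv (e i) * tv (f i))%g ((tv (e i) * tv (f i))%g *m v) +
   c (tv (e i) * tv (f i))%g v = 0.
  by rewrite -(cM hc); have := vr i v; rewrite ord3_def expgS expg1.
have E1 i : c (tv (f i)) (e i) = 0.
  have := ord i (e i); rewrite !rho SpM !tvE !omE ?eqxx /= => A.
  by apply: (eq_of_diff2 A (esym (T (tv (e i)) (f i)))); ring.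
have E2 i : c (tv (e i)) (f i) = 0.
  by have := ord i (f i); rewrite !rho SpM !tvE !omE ?eqxx /= E1 => A; apply: (eq_of_diff A); ring.
split=> i v; first by rewrite (ceE hg quadr_of_form hc hp) be E2; ring.
by rewrite (cfE hg quadr_of_form hc hp) bf E1; ring.
Qed.

Section Triple.
Variable c : G -> V -> R.
Hypothesis hc : cocycle 2%:R c.
Hypothesis vr : forall i, vanish c (ord3 R i).

Let T x v : 2%:R * c x v = 0. Proof. exact: (cT hc). Qed.
Let hp := even_plane hg quadr_of_form hc T vr.
Let ho := even_ortho quadr_of_form hc T vr.
Let ve := proj1 (even_long_roots hc vr).
Let vf := proj2 (even_long_roots hc vr).

Lemma even_pair_e i j : i != j -> c (tv (e i + e j)) (e j) = 0.
Proof. by move=> nij; have := pair_e_f quadr_of_form hc ve vf nij; rewrite T addr0. Qed.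

Lemma even_pairE i j : i != j -> forall v, let r := c (tv (e i + e j)) in
  r v = yc v i ^+ 2 * r (f i) + yc v j ^+ 2 * r (f j) + yc v i * yc v j * (r (f i) + r (f j)).
Proof.
move=> nij v r; apply: (pairE quadr_of_form hc ho hp ve vf nij).
  by rewrite addrC even_pair_e // eq_sym.
exact: even_pair_e.
Qed.

(** Up to factors tv (e i), tv (e j), tv (e k), on which c vanishes, the
    transvection t along e i + e j + e k is the product of the transvections
    along the three sums of two of these vectors, which gives c t.  It commutes
    with tv (f i - f j), and evaluating the commutation at e i yields the
    equality. *)
Lemma even_triple i j k : i != j -> i != k -> j != k ->
  c (tv (e i + e k)) (f i) = c (tv (e j + e k)) (f j).
Proof.
move=> nij nik njk.
have [nji nki nkj] : [/\ (j == i) = false, (k == i) = false & (k == j) = false].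
  by split; apply/negbTE; rewrite eq_sym.
pose t := tv (e i + e j + e k); pose y := (tv (e i) * tv (e j) * tv (e k))%g.
have vy : vanish c y by apply: (vanishM hc (vanishM hc (ve i) (ve j)) (ve k)).
have rel : (t * y = tv (e i + e j) * tv (e i + e k) * tv (e j + e k))%g.
  apply: Sp_ext => v; rewrite !SpM !tvE !omE.
  by apply: vecP => l; rewrite !coordE; ring.
have tE v : c t (y *m v) = c (tv (e i + e j)) v + c (tv (e i + e k)) v + c (tv (e j + e k)) v.
  have := congr1 (c^~ v) rel; rewrite (cM hc t y) vy addr0 => ->.
  have Y i1 i2 w l : yc (tv (e i1 + e i2) *m w) l = yc w l by rewrite tvE !coordE; ring.
  have D i1 i2 w : i1 != i2 -> (forall l, yc w l = yc v l) ->
      c (tv (e i1 + e i2)) w = c (tv (e i1 + e i2)) v.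
    by move=> n12 yw; rewrite (even_pairE n12 w) (even_pairE n12 v) !yw.
  by rewrite (cM hc) (cM hc) !D // => l; rewrite !Y.
have C : (t * tv (f i - f j) = tv (f i - f j) * t)%g.
  by apply: tv_comm; rewrite !omE ?eqxx ?nji ?nki ?nkj ?(negPf nij) ?(negPf nik) ?(negPf njk) /=; ring.
have te : t *m e i = e i by rewrite tvE !omE !addr0 scale0r addr0.
have := fixed_inv hc C te.
have -> : tv (f i - f j) *m e i = y *m (e i + e i - e j - f i + f j).
  rewrite !SpM !tvE !omE; apply: vecP => l; rewrite !coordE ?eqxx ?nji ?nki ?nkj ?(negPf nij) ?(negPf nik) ?(negPf njk) /=; ring.
have ee l : tv (e l) *m e i = e i by rewrite tvE om_e coordE scale0r addr0.
have ye : y *m e i = e i by rewrite !SpM !ee.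
rewrite -[X in _ = c t X -> _]ye.
rewrite !tE (even_pairE nij (_ + _)) (even_pairE nik (_ + _)) (even_pairE njk (_ + _)).
rewrite (even_pairE nij (e i)) (even_pairE nik (e i)) (even_pairE njk (e i)) !omE ?eqxx ?nji ?nki ?nkj ?(negPf nij) ?(negPf nik) ?(negPf njk) /= => A.
by apply: (eq_of_diff2 A (esym (T (tv (e j + e k)) (f j)))); ring.
Qed.

(** The forms x^2 + x y + y^2 of the planes are SL_2-invariant modulo 2, so
    subtracting their coboundary does not change c on tv (e i) and tv (f i).
    By [even_triple] the coefficient al k does not depend on the plane p k used
    to define it. *)
Lemma even_trivial_ord3 : trivial c.
Proof.
pose p k : 'I_g := odflt k [pick i | i != k].
have pk k : p k != k.
  rewrite /p; case: pickP => [i //|h]; have [i ni _] := other_plane hg k k.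
  by have := h i; rewrite ni.
pose al k := c (tv (e (p k) + e k)) (f (p k)).
have alE i k : i != k -> c (tv (e i + e k)) (f i) = al k.
  move=> nik; rewrite /al; case: (eqVneq i (p k)) => [<-//|ni].
  exact: even_triple.
pose F := plane_sum (fun i a b => al i * (a ^+ 2 + a * b + b ^+ 2)).
have hF : form F.
  apply: form_sum => i; apply: formZ; apply: formD; last exact: form_yy.
  by apply: formD; [exact: form_xx | exact: form_xy].
have Tal i : 2%:R * al i = 0 by apply: T.
have tF v : 2%:R * F v = 0.
  by rewrite mulr_sumr big1 // => i _; rewrite mulrA Tal mul0r.
have hc' := twist_cocycle hc hF tF.
apply: (twist_trivial hF); apply: (vanish_all generation hc') => [i v|i v|i j nij v].
- rewrite /twist ve /F (@plane_sum1 _ i); last first.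
    by move=> k nk; rewrite tvE !omE (negPf nk) /=; split; ring.
  rewrite tvE !omE eqxx /=.
  by apply: (eq_of_diff (congr1 (fun z => z * - (xc v i * yc v i + yc v i ^+ 2)) (Tal i))); ring.
- rewrite /twist vf /F (@plane_sum1 _ i); last first.
    by move=> k nk; rewrite tvE !omE (negPf nk) /=; split; ring.
  rewrite tvE !omE eqxx /=.
  by apply: (eq_of_diff (congr1 (fun z => z * (xc v i * yc v i)) (Tal i))); ring.
have nji : j != i by rewrite eq_sym.
rewrite /twist even_pairE // alE // [e i + e j]addrC alE //.
rewrite /F (plane_sum2 _ nij); last first.
  by move=> k ki kj; rewrite tvE !omE (negPf ki) (negPf kj) /=; split; ring.
rewrite tvE !omE !eqxx (negPf nij) (negPf nji) /=.
set xi := xc v i; set xj := xc v j; set yi := yc v i; set yj := yc v j.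
pose z1 := xi * (yi + yj) + yi ^+ 2 + yi * yj; pose z2 := xj * (yi + yj) + yj ^+ 2 + yi * yj.
apply: (eq_of_diff2 (congr1 (fun z => z * - z1) (Tal i)) (congr1 (fun z => z * - z2) (Tal j))).
by rewrite /z1 /z2; ring.
Qed.

End Triple.

Lemma even_trivial c : cocycle 2%:R c -> trivial c.
Proof.
move=> hc; have [|F [h1 h2 h3]] := normalize (n' := 1) hc (@ord3X R g) (@ord3_comm R g).
  by move=> a ha; rewrite mul1r; apply: (eq_of_diff ha); ring.
by apply: (twist_trivial h1); apply: even_trivial_ord3 => //; apply: twist_cocycle.
Qed.

End EvenStage.
End Conclusion.

Lemma ZpL0 L : (1 < L)%N -> L%:R = 0 :> 'Z_L.
Proof. by move=> hL; apply: val_inj; rewrite /= val_Zp_nat // modnn. Qed.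

(** For L = 2m, the components m c and (1 - m) c are killed by 2 and m.  In the
    odd part the inverse of 2 is (m + 1) / 2, which is the successor of m./2. *)
Lemma cocycle_trivial (L g : nat) (c : Sp 'Z_L g -> 'cV['Z_L]_(g + g) -> 'Z_L) :
  (2 < g)%N -> (1 < L)%N -> ~~ (4 %| L)%N -> cocycle 0 c -> trivial c.
Proof.
move=> hg hL h4 hc; have L0 := ZpL0 hL.
have fq F := @form_quadr L g F hL.
have gen := @Sp_generation L g hL.
have scale a tau : tau * a = 0 -> cocycle tau (fun x v => a * c x v).
  move=> ta; split=> [x y v|x|x v]; last by rewrite mulrA ta mul0r.
    by rewrite (cM hc) mulrDr.
  exact/formZ/(cF hc).
have LE (A : nzRingType) : L%:R = (odd L)%:R + 2%:R * L./2%:R :> A.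
  by rewrite -{1}(odd_double_half L) natrD -muln2 natrM mulr_natl mulr_natr.
have := LE 'Z_L; rewrite L0; case: (boolP (odd L)) => [oL|eL] {}LE.
  apply: (odd_trivial hg fq gen (h := (L./2.+1)%:R) _ hc).
  by apply: (eq_of_diff (esym LE)); rewrite -[L./2.+1%:R]natr1 /=; ring.
pose m := L./2; have Lm : L = (2 * m)%N by rewrite mul2n -[LHS]odd_double_half (negPf eL).
have om : odd m.
  by apply: contraR h4 => em; rewrite Lm -(odd_double_half m) (negPf em) -muln2 add0n mulnCA dvdn_mull.
have m2 : (2 * m)%:R = 0 :> 'Z_L by rewrite -Lm.
have mE : m%:R = 1 + 2%:R * m./2%:R :> 'Z_L.
  by rewrite -{1}(odd_double_half m) om natrD -muln2 natrM mulr_natl mulr_natr.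
have [F1 f1 E1] : trivial (fun x v => m%:R * c x v).
  by apply: (even_trivial hg fq gen om m2); apply: scale; rewrite -natrM.
have [F2 f2 E2] : trivial (fun x v => (1 - m%:R) * c x v).
  apply: (odd_trivial hg fq gen (h := (m./2.+1)%:R) erefl); apply: scale.
  have -> : (1 - 2%:R * m./2.+1%:R) * (1 - m%:R) = (2 * m)%:R * (m./2)%:R :> 'Z_L.
    by rewrite natrM mE -[m./2.+1%:R]natr1; ring.
  by rewrite m2 mul0r.
exists (fun v => F1 v + F2 v); first exact: formD.
by move=> x v; apply: (eq_of_diff2 (E1 x v) (E2 x v)); ring.
Qed.

(** * Characters of finite abelian groups *)

(** A nontrivial element of the quotient by B is not in the kernel of some linear
    complex character, whose values are n-th roots of unity; their discrete
    logarithm takes values in Z/n. *)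
Lemma char_separates (gT : finGroupType) (B : {group gT}) (x : gT) n :
  (1 < n)%N -> abelian [set: gT] -> (forall y : gT, y ^+ n = 1)%g -> x \notin B ->
  exists chi : gT -> 'Z_n, [/\ forall y z, chi (y * z)%g = chi y + chi z,
    forall y, y \in B -> chi y = 0 & chi x <> 0].
Proof.
move=> n1 cG expn xB; have nB y : y \in 'N(B)%g.
  by apply: (subsetP (sub_abelian_norm cG (subsetT B))); rewrite inE.
pose Q := ([set: gT] / B)%G; have cQ : abelian Q by apply: quotient_abelian.
have xQ y : coset B y \in Q by apply: mem_quotient; rewrite inE.
have x1 : coset B x \notin [1 coset_of B]%g.
  by apply: contra xB => /set1P h; apply: coset_idr.
have [i xi] : exists i : Iirr Q, coset B x \notin cfker 'chi_i.
  apply/existsP; apply: contraR x1; rewrite negb_exists => /forallP h.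
  rewrite -(TI_cfker_irr Q); apply/bigcapP => i _; by have := h i; rewrite negbK.
have li : 'chi_i \is a linear_char by apply/char_abelianP.
have n0 : (0 < n)%N by apply: ltnW.
have [z pz] := C_prim_root_exists n0.
have [ix chiz] : exists ix : gT -> 'I_n, forall y, 'chi_i (coset B y) = z ^+ ix y.
  apply: (@fin_all_exists gT (fun=> 'I_n) (fun y k => 'chi_i (coset B y) = z ^+ k)) => y.
  have [|k ->] := prim_rootP pz (_ : 'chi_i (coset B y) ^+ n = 1); last by exists k.
  by rewrite -lin_charX // -morphX // expn morph1 lin_char1.
pose chi y : 'Z_n := (ix y : nat)%:R.
have chiE y k : 'chi_i (coset B y) = z ^+ k -> chi y = k%:R.
  rewrite chiz => /eqP; rewrite (eq_prim_root_expr pz) => /eqP E.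
  by apply: val_inj; rewrite /= !val_Zp_nat // E.
exists chi; split=> [y1 y2|y yB|x0].
- rewrite (chiE _ (ix y1 + ix y2)%N) ?natrD //.
  by rewrite morphM ?nB //= lin_charM // exprD; congr (_ * _); apply: chiz.
- by rewrite (chiE _ 0%N) // coset_id // lin_char1.
case/negP: xi; rewrite cfkerEirr inE (lin_char1 li) chiz.
have : (ix x)%:R = 0%:R :> 'Z_n by [].
move/(congr1 val); rewrite /= !val_Zp_nat // => E.
by rewrite -(prim_expr_mod pz) E ?mod0n expr0 ?eqxx.
Qed.

(** * From cocycles to homology *)

Section Span.
Variables (R : comNzRingType) (g : nat).
Local Notation V := 'cV[R]_(g + g).
Local Notation J := (Omega R g).
Implicit Types (u v : V) (p q : 'I_(g + g)).

Lemma sp_lie_sym (m : sp_lie R g) : (val m *m J)^T = val m *m J.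
Proof.
have h := eqP (sp_lieP m); rewrite trmx_mul trJ mulNmx.
have J2 := Omega2 R g.
have E : val m = J *m (val m)^T *m J.
  have -> : J *m (val m)^T *m J = J *m ((val m)^T *m J) by rewrite mulmxA.
  have -> : (val m)^T *m J = - (J *m val m) by apply/eqP; rewrite -addr_eq0 h.
  by rewrite mulmxN mulmxA J2 mulNmx mul1mx opprK.
by rewrite [in RHS]E -mulmxA J2 mulmxN mulmx1.
Qed.

Definition std_basis p : V := delta_mx p 0.

Lemma tlog_polar u v : tlog (u + v) - tlog u - tlog v = (u *m v^T + v *m u^T) *m J.
Proof.
by rewrite /tlog -!lock linearD /= !mulmxDl !mulmxDr !mulmxDl; apply/matrixP=> p q; rewrite !mxE; ring.
Qed.

(** Elements of the Lie algebra are the products S J with S symmetric.  The column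
    vector u p collects the entries of S above the diagonal in column p, and the
    polarization of spv at (u p, b_p) supplies these entries together with their
    mirror images; the diagonal of S is added through the spv b_p. *)
Lemma sp_lie_span (m : sp_lie R g) :
  exists (u : 'I_(g + g) -> V) (a : 'I_(g + g) -> R),
  val m = \sum_p (val (spv (u p + std_basis p) - spv (u p) - spv (std_basis p))
                  + a p *: val (spv (std_basis p))).
Proof.
have [S SS mE] : exists2 S : 'M[R]_(g + g), S^T = S & val m = S *m J.
  exists (- (val m *m J)); first by rewrite linearN /= sp_lie_sym.
  by rewrite mulNmx -mulmxA Omega2 mulmxN mulmx1 opprK.
pose u p : V := \col_q (if (q < p)%N then S q p else 0).
exists u, (fun p => S p p); rewrite mE.
have E p : val (spv (u p + std_basis p) - spv (u p) - spv (std_basis p)) + S p p *: val (spv (std_basis p))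
  = (u p *m (std_basis p)^T + std_basis p *m (u p)^T + S p p *: (std_basis p *m (std_basis p)^T)) *m J.
  by rewrite mulmxDl -tlog_polar /= -scalemxAl /tlog -!lock.
rewrite (eq_bigr _ (fun p _ => E p)) -mulmx_suml; congr (_ *m _).
apply/matrixP=> i j; rewrite summxE.
pose d (q p : 'I_(g + g)) : R := (q == p)%:R.
have E2 p : (u p *m (std_basis p)^T + std_basis p *m (u p)^T + S p p *: (std_basis p *m (std_basis p)^T)) i j =
  u p i 0 * d j p + d i p * u p j 0 + S p p * (d i p * d j p).
  by rewrite !mxE !big_ord1 !mxE !eqxx !andbT.
rewrite (eq_bigr _ (fun p _ => E2 p)) !big_split /=.
have dd q p : q != p -> d q p = 0 by rewrite /d => /negPf ->.
have d1 q : d q q = 1 by rewrite /d eqxx.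
rewrite (bigD1 j) //= big1 ?addr0 => [|p np]; last by rewrite (dd j) ?mulr0 // eq_sym.
rewrite (bigD1 i) //= big1 ?addr0 => [|p np]; last by rewrite (dd i) ?mul0r // eq_sym.
rewrite (bigD1 i) //= big1 ?addr0 => [|p np]; last by rewrite (dd i) ?mul0r ?mulr0 // eq_sym.
rewrite !d1 !mxE mulr1 !mul1r.
have Sji : S j i = S i j by rewrite -[in LHS]SS mxE.
case: (ltngtP i j) => [ij|ji|/val_inj ->].
- have ne : j != i by apply: contraTneq ij => ->; rewrite ltnn.
  by rewrite (dd j i ne) !mulr0 !addr0.
- have ne : j != i by apply: contraTneq ji => ->; rewrite ltnn.
  by rewrite (dd j i ne) !mulr0 add0r addr0 Sji.
by rewrite d1 mulr1 !add0r.
Qed.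

End Span.

Lemma additive_eq (L g : nat) (p1 p2 : sp_lie 'Z_L g -> 'Z_L) : (1 < L)%N ->
  (forall m n, p1 (m + n) = p1 m + p1 n) -> (forall m n, p2 (m + n) = p2 m + p2 n) ->
  (forall v, p1 (spv v) = p2 (spv v)) -> forall m, p1 m = p2 m.
Proof.
move=> hL h1 h2 h m.
have B (p : sp_lie 'Z_L g -> 'Z_L) : (forall m n, p (m + n) = p m + p n) ->
    forall m n, p (m - n) = p m - p n.
  by move=> hp m' n; apply/eqP; rewrite eq_sym subr_eq -hp subrK.
have [u [a E]] := sp_lie_span m.
have -> : m = \sum_p (spv (u p + std_basis _ p) - spv (u p) - spv (std_basis _ p)
                  + spv (std_basis _ p) *+ (nat_of_ord (a p))).
  apply: val_inj; rewrite E (big_morph val (fun _ _ => erefl) erefl).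
  apply: eq_bigr => p _; rewrite -{1}[a p]natr_Zp -val_muln; exact: erefl.
have S0 (p : sp_lie 'Z_L g -> 'Z_L) : (forall m n, p (m + n) = p m + p n) -> p 0 = 0.
  by move=> hp; apply: (addrI (p 0)); rewrite -hp !addr0.
rewrite (big_morph p1 h1 (S0 _ h1)) (big_morph p2 h2 (S0 _ h2)).
by apply: eq_bigr => p _; rewrite h1 h2 !(B _ h1) !(B _ h2) !additive_muln // !h.
Qed.

Section Homology.
Variables (L g : nat) (hL : (1 < L)%N).
Local Notation R := 'Z_L.
Local Notation G := (Sp R g).
Local Notation M := (sp_module R g).
Local Notation C1 := (chain M 1).

Definition word1 (x : G) : {ffun 'I_1 -> G} := [ffun=> x].
Definition word2 (x y : G) : {ffun 'I_2 -> G} := [ffun i => if i == ord0 then x else y].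
Definition cell n (s : {ffun 'I_n -> G}) (m : M) : chain M n :=
  [ffun t => if t == s then m else 0].

Lemma cellD n (s : {ffun 'I_n -> G}) (m1 m2 : M) :
  cell s (m1 + m2) = cell s m1 + cell s m2 :> {ffun _ -> M}.
Proof. by apply/ffunP=> t; rewrite !ffunE; case: ifP; rewrite ?addr0. Qed.

Lemma cell_sum n (c : chain M n) : c = \sum_s (cell s (c s) : {ffun _ -> M}).
Proof.
apply/ffunP=> t; rewrite sum_ffunE (bigD1 t) //= big1 => [|s ns].
  by rewrite ffunE eqxx addr0.
by rewrite ffunE eq_sym (negPf ns).
Qed.

Lemma bar_diff_cell x y m :
  bar_diff (cell (word2 x y) m) =
  cell (word1 y) (gmod_act x^-1%g m) - cell (word1 (x * y)%g) m + cell (word1 x) m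
  :> {ffun _ -> M}.
Proof.
apply/ffunP=> t; rewrite !ffunE (bigD1 (word2 x y)) //= [X in _ + X]big1 ?addr0 => [|s ns]; last first.
  rewrite big1 // => i _; rewrite /bar_coef ffunE (negPf ns).
  case: ifP => _; last by rewrite mul0rz.
  rewrite -[gmod_act _ _]/(sp_conj _ _).
  have -> : sp_conj (s ord0)^-1%g 0 = 0 by apply: val_inj; rewrite /= mulmx0 mul0mx.
  by rewrite mul0rz.
rewrite big_mkcond /= !big_ord_recl big_ord0 addr0 /bar_coef /= !ffunE eqxx /=.
have f0 : bar_face ord0 (word2 x y) = word1 y.
  by apply/ffunP=> j; rewrite !ffunE (ord1 j).
have f1 : bar_face (lift ord0 ord0) (word2 x y) = word1 (x * y)%g.
  by apply/ffunP=> j; rewrite !ffunE (ord1 j).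
have f2 : bar_face (lift ord0 (lift ord0 ord0)) (word2 x y) = word1 x.
  by apply/ffunP=> j; rewrite !ffunE (ord1 j).
rewrite f0 f1 f2 !(eq_sym _ t).
have h1 (a : M) : a *~ (-1) ^+ bump 0 0 = - a by rewrite /bump expr1 mulrN1z.
have h2 (a : M) : a *~ (-1) ^+ bump 0 (bump 0 0) = a by rewrite /bump sqrrN expr1n mulr1z.
rewrite eqxx h1 !h2 addrA.
by case: ifP; case: ifP; case: ifP; rewrite ?oppr0.
Qed.

Lemma chain_expg (c : C1) n : (c ^+ n)%g = (c : {ffun _ -> M}) *+ n.
Proof. by elim: n => [|n IH]; rewrite ?expg0 // expgS IH mulrS. Qed.

Lemma chain_expL (c : C1) : (c ^+ L = 1)%g.
Proof.
rewrite chain_expg; apply/ffunP=> s; rewrite ffunMnE [RHS]ffunE; apply: val_inj.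
by rewrite /= val_muln ZpL0 // scale0r.
Qed.

Lemma bar_diff0 (c : C1) t :
  bar_diff c t = \sum_(s : {ffun 'I_1 -> G}) (sp_conj (s ord0)^-1%g (c s) - c s).
Proof.
rewrite ffunE; apply: eq_bigr => s _; rewrite big_mkcond /= !big_ord_recl big_ord0 addr0.
have e u : (bar_face u s == t) = true by apply/eqP/ffunP=> -[].
by rewrite !e /bar_coef /= expr0 mulr1z /bump expr1 mulrN1z.
Qed.

(** A character chi that kills boundaries is, on the chains [x] with coefficient
    m, a function d x m satisfying the cocycle identity [dM].  Triviality of the
    associated cocycle writes d x m as phi (x^-1 m) - phi m, so chi is phi
    composed with the differential and kills the cycle z. *)
Lemma H1_sp_eq0 : (2 < g)%N -> ~~ (4 %| L)%N -> group_homology M 1 :=: 1%g.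
Proof.
move=> hg h4; apply: quotientS1; apply/subsetP=> z zc; apply: contraT => zB.
have cC : abelian [set: C1] by apply/centsP=> a _ b _; exact: addrC.
have [chi [chiD chiB chiz]] := char_separates hL cC chain_expL zB.
have chi0 : chi 0 = 0 by apply: chiB; exact: group1.
have {}chiD (a b : {ffun {ffun 'I_1 -> G} -> M}) : chi (a + b) = chi a + chi b by exact: chiD.
have chiN (a b : {ffun {ffun 'I_1 -> G} -> M}) : chi (a - b) = chi a - chi b.
  by apply/eqP; rewrite eq_sym subr_eq -chiD subrK.
pose d (x : G) (m : M) := chi (cell (word1 x) m).
have dD x m1 m2 : d x (m1 + m2) = d x m1 + d x m2 by rewrite /d cellD chiD.
have dM x y m : d (x * y)%g m = d y (sp_conj x^-1%g m) + d x m.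
  have : chi (bar_diff (cell (word2 x y) m)) = 0.
    by apply: chiB; apply: mem_morphim; rewrite inE.
  by rewrite bar_diff_cell chiD chiN => A; apply: (eq_of_diff (esym A)); rewrite /d; ring.
pose c x v := d x^-1%g (spv v).
have hc : cocycle 0 c.
  split=> [x y v|x|x v]; last by rewrite mul0r.
    by rewrite /c invMg dM invgK -spv_conj.
  by exists (d x^-1%g).
have [F [phi phiD FE] cE] := cocycle_trivial hg hL h4 hc.
have dE x m : d x m = phi (sp_conj x^-1%g m) - phi m.
  apply: (additive_eq (p2 := fun m => phi (sp_conj x^-1%g m) - phi m) hL (dD x)) => [m1 m2|v].
    by rewrite sp_conjD !phiD; ring.
  by have := cE x^-1%g v; rewrite /c invgK !FE spv_conj.
case: chiz.
have phi0 : phi 0 = 0 by apply: (addrI (phi 0)); rewrite -phiD !addr0.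
have phiB m n : phi (m - n) = phi m - phi n.
  by apply/eqP; rewrite eq_sym subr_eq -phiD subrK.
have E1 : chi z = \sum_s chi (cell s (z s)).
  by rewrite {1}[z]cell_sum (big_morph chi chiD chi0).
have E2 s : chi (cell s (z s)) = phi (sp_conj (s ord0)^-1%g (z s) - z s).
  rewrite phiB -dE /d; congr (chi (cell _ _)).
  by apply/ffunP=> j; rewrite ffunE (ord1 j).
rewrite E1 (eq_bigr _ (fun s _ => E2 s)) -(big_morph phi phiD phi0).
have [t _] : exists t : {ffun 'I_0 -> G}, true by exists [ffun=> 1%g].
rewrite -(bar_diff0 z t).
have /eqP -> : bar_diff z == 0 by move: zc; rewrite !inE.
by rewrite ffunE.
Qed.
End Homology.

Theorem theorem7 (g L : nat) (hg : (3 <= g)%N) (hL : (2 <= L)%N)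
    (h4 : ~~ (4 %| L)%N) :
  group_homology (sp_module 'Z_L g) 1 :=: 1%g.
Proof. exact: H1_sp_eq0. Qed.
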